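(* Assume: $f=F\circ G$ is convex and $h$ is $\mu$-strongly convex with $\mu>0$; every $F_i$ is $L_F$-smooth with $B_F$-bounded gradient and every $G_j$ is $L_G$-smooth with $B_G$-bounded Jacobian; $\|[\nabla G_j(x)]^\top\nabla F_i(G(x))-[\nabla G_j(y)]^\top\nabla F_i(G(y))\|\le L\|x-y\|$ for all $i\in[n_1]$, $j\in[n_2]$ and $x,y\in\mathbb R^{N_2}$; and $L\ge\mu$. Let $x^*$ be the minimizer of $H=f+h$. Let $\{\widetilde x^s\}$ be generated by the algorithm SoCK with Option I, started at $x_0$, with parameters $$m=\left\lceil \tfrac12\sqrt{L/\mu}\right\rceil,\quad \tau_1=\tau_2=\frac1{2m},\quad \theta=1+\frac1{12m},\quad \alpha=\frac1{3\tau_1L},\quad A=\frac{720B_G^4L_F^2}{\mu^2},\quad B=\frac{720B_F^2L_G^2}{\mu^2},$$ where the values of $A$ and $B$ are rounded up to the nearest positive integer. Then, for every number $S\ge1$ of outer loops, $$\mathbb E\big[H(\widetilde x^{S})-H(x^* )\big]\le 11\left(\frac{12}{13}\right)^{S}\big(H(x_0)-H(x^* )\big).$$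
   Context: Problem: $\min_{x\in\mathbb R^{N_2}}H(x)=f(x)+h(x)$ with $f=F\circ G$, $F=\frac1{n_1}\sum_{i=1}^{n_1}F_i$, $G=\frac1{n_2}\sum_{j=1}^{n_2}G_j$, where $F_i:\mathbb R^{N_1}\to\mathbb R$ and $G_j:\mathbb R^{N_2}\to\mathbb R^{N_1}$ are differentiable and $h:\mathbb R^{N_2}\to\mathbb R\cup\{+\infty\}$ is a proper closed convex function (possibly non-differentiable). $\nabla$ denotes the gradient of a scalar function and the Jacobian matrix of a vector-valued map; $\|\cdot\|$ is the Euclidean norm of vectors and the spectral norm of matrices; $[n]=\{1,\dots,n\}$. A differentiable map $\phi$ is $l$-smooth if $\|\nabla\phi(x)-\nabla\phi(x')\|\le l\|x-x'\|$ for all $x,x'$; it has $b$-bounded gradient/Jacobian if $\|\nabla\phi(x)\|\le b$ for all $x$. $h$ is $\mu$-strongly convex if $h(x')\ge h(x)+\langle g,x'-x\rangle+\frac\mu2\|x'-x\|^2$ for every $x,x'$ and every subgradient $g$ of $h$ at $x$. Algorithm SoCK (Option I). Inputs: $x_0\in\mathbb R^{N_2}$ with $h(x_0)<\infty$, positive integers $S,m,A,B$, reals $\theta>1$, $\alpha>0$, $\tau_1,\tau_2$. Set $y_0=z_0=\widetilde x^0=x_0$. For $s=0,\dots,S-1$: for $j=0,\dots,m-1$, put $k=sm+j$ and (1) $x_{k+1}=\tau_1z_k+\tau_2\widetilde x^s+(1-\tau_1-\tau_2)y_k$; (2) draw multisets $\mathcal A_k,\mathcal B_k$ uniformly at random with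 replacement from $[n_2]$, with $|\mathcal A_k|=A$, $|\mathcal B_k|=B$ (all draws mutually independent); (3) $\widehat G_k=\frac1A\sum_{i\in\mathcal A_k}(G_i(x_{k+1})-G_i(\widetilde x^s))+G(\widetilde x^s)$ and $\nabla\widehat G_k=\frac1B\sum_{i\in\mathcal B_k}(\nabla G_i(x_{k+1})-\nabla G_i(\widetilde x^s))+\nabla G(\widetilde x^s)$; (4) $\widetilde\nabla_{k+1}=[\nabla\widehat G_k]^\top\nabla F(\widehat G_k)$; (5) $z_{k+1}=\arg\min_z\{\langle\widetilde\nabla_{k+1},z\rangle+\frac1{2\alpha}\|z-z_k\|^2+h(z)\}$; (6) $y_{k+1}=\arg\min_y\{\langle\widetilde\nabla_{k+1},y\rangle+\frac{3L}2\|y-x_{k+1}\|^2+h(y)\}$. After the inner loop, $\widetilde x^{s+1}=\big(\sum_{j=0}^{m-1}\theta^j\big)^{-1}\sum_{j=0}^{m-1}\theta^jy_{sm+j+1}$. The output is $\widetilde x^S$. $\mathbb E$ is expectation over all random draws. *)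

(* Defs.v *)
From HB Require Import structures.
From mathcomp Require Import all_boot all_order all_algebra.
From mathcomp Require Import all_classical all_reals all_analysis.

Set Implicit Arguments.
Unset Strict Implicit.
Unset Printing Implicit Defensive.

Import Order.TTheory GRing.Theory Num.Theory.
Import numFieldNormedType.Exports.

Local Open Scope classical_set_scope.
Local Open Scope ring_scope.

(* A point of R^N is a row vector ['rV[R]_N], since the Jacobian ['J] of
   MathComp-Analysis is defined on row vectors. The library norm [`|x|] on
   matrices is the max norm (it induces the usual topology, hence the
   usual differentiability); quantitative statements use [enorm], [specnorm]. *)

Definition dotp (R : realType) (N : nat) (u v : 'rV[R]_N) : R :=
  \sum_(i < N) u 0 i * v 0 i.

Definition enorm (R : realType) (N : nat) (u : 'rV[R]_N) : R :=
  Num.sqrt (dotp u u).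

(* As vectors are rows, [v *m M^T] is the matrix-vector product M v. *)
Definition specnorm (R : realType) (p q : nat) (M : 'M[R]_(p, q)) : R :=
  sup [set enorm (v *m M^T) | v in [set v : 'rV[R]_q | enorm v <= 1]].

Definition grad (R : realType) (N : nat) (phi : 'rV[R]_N -> R^o)
    (x : 'rV[R]_N) : 'rV[R]_N :=
  \row_(i < N) 'D_(delta_mx 0 i) phi x.

(* ['J g x] acts on rows from the right, so the usual Jacobian, whose (i, j)
   entry is the j-th partial derivative of the i-th component, is its
   transpose. *)
Definition jac (R : realType) (N M : nat) (g : 'rV[R]_N -> 'rV[R]_M)
    (x : 'rV[R]_N) : 'M[R]_(M, N) := ('J g x)^T.

(* The vector J^T v, for vectors represented as rows. *)
Definition trmul (R : realType) (M N : nat) (J : 'M[R]_(M, N))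
    (v : 'rV[R]_M) : 'rV[R]_N := v *m J.

Definition smooth_fun (R : realType) (N : nat) (l : R)
    (phi : 'rV[R]_N -> R^o) : Prop :=
  (forall x, differentiable phi x) /\
  forall x x', enorm (grad phi x - grad phi x') <= l * enorm (x - x').

Definition smooth_map (R : realType) (N M : nat) (l : R)
    (g : 'rV[R]_N -> 'rV[R]_M) : Prop :=
  (forall x, differentiable g x) /\
  forall x x', specnorm (jac g x - jac g x') <= l * enorm (x - x').

Definition mean (R : realType) (V : lmodType R) (n : nat) (v : 'I_n -> V) : V :=
  n%:R^-1 *: \sum_(i < n) v i.

Definition avg (R : realType) (T : Type) (V : lmodType R) (n : nat)
    (phi : 'I_n -> T -> V) (x : T) : V := mean (fun i => phi i x).

Definition proper (R : realType) (N : nat) (h : 'rV[R]_N -> \bar R) : Prop :=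
  (forall x, h x != -oo%E) /\ exists x, (h x < +oo)%E.

(* [0 * +oo = 0] in [\bar R], so the cases t = 0 and t = 1 are trivial. *)
Definition econvex (R : realType) (N : nat) (h : 'rV[R]_N -> \bar R) : Prop :=
  forall (x y : 'rV[R]_N) (t : R), 0 <= t <= 1 ->
    (h (t *: x + (1 - t) *: y)%R <= t%:E * h x + (1 - t)%:E * h y)%E.

(* A function is closed when its epigraph is, i.e. when it is lower
   semicontinuous. *)
Definition proper_closed_convex (R : realType) (N : nat)
    (h : 'rV[R]_N -> \bar R) : Prop :=
  [/\ proper h, lower_semicontinuous h & econvex h].

(* For a proper h, the inequality forces h x to be finite. *)
Definition subgradient (R : realType) (N : nat) (h : 'rV[R]_N -> \bar R)
    (x g : 'rV[R]_N) : Prop :=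
  forall x', (h x + (dotp g (x' - x))%:E <= h x')%E.

Definition strongly_convex (R : realType) (N : nat) (mu : R)
    (h : 'rV[R]_N -> \bar R) : Prop :=
  forall x x' g, subgradient h x g ->
    (h x + (dotp g (x' - x) + mu / 2 * enorm (x' - x) ^+ 2)%:E <= h x')%E.

Definition is_minimizer (R : realType) (V : Type) (phi : V -> \bar R)
    (p : V) : Prop := forall q, (phi p <= phi q)%E.

Record iterates (R : realType) (N : nat) := Iterates {
  it_x : nat -> 'rV[R]_N;
  it_y : nat -> 'rV[R]_N;
  it_z : nat -> 'rV[R]_N;
  it_snap : nat -> 'rV[R]_N (* the snapshots \tilde x^s *)
}.

Definition hatG (R : realType) (N1 N2 n2 A : nat)
    (G_ : 'I_n2 -> 'rV[R]_N2 -> 'rV[R]_N1) (a : 'I_A -> 'I_n2)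
    (x xt : 'rV[R]_N2) : 'rV[R]_N1 :=
  mean (fun i => G_ (a i) x - G_ (a i) xt) + avg G_ xt.

Definition hat_jacG (R : realType) (N1 N2 n2 B : nat)
    (G_ : 'I_n2 -> 'rV[R]_N2 -> 'rV[R]_N1) (b : 'I_B -> 'I_n2)
    (x xt : 'rV[R]_N2) : 'M[R]_(N1, N2) :=
  mean (fun i => jac (G_ (b i)) x - jac (G_ (b i)) xt) + jac (avg G_) xt.

Definition grad_est (R : realType) (N1 N2 n2 A B : nat)
    (F : 'rV[R]_N1 -> R^o) (G_ : 'I_n2 -> 'rV[R]_N2 -> 'rV[R]_N1)
    (a : 'I_A -> 'I_n2) (b : 'I_B -> 'I_n2) (x xt : 'rV[R]_N2) : 'rV[R]_N2 :=
  trmul (hat_jacG G_ b x xt) (grad F (hatG G_ a x xt)).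

(* [sock ... a b r]: r is a trajectory of the algorithm SoCK (Option I) with S
   outer loops when, at iteration k = s m + j, the drawn multisets are
   {a k i | i < A} and {b k i | i < B}. *)
Record sock (R : realType) (N1 N2 n2 : nat) (F : 'rV[R]_N1 -> R^o)
    (G_ : 'I_n2 -> 'rV[R]_N2 -> 'rV[R]_N1) (h : 'rV[R]_N2 -> \bar R) (L : R)
    (x0 : 'rV[R]_N2) (S m A B : nat) (theta alpha tau1 tau2 : R)
    (a : nat -> 'I_A -> 'I_n2) (b : nat -> 'I_B -> 'I_n2)
    (r : iterates R N2) : Prop := Sock {
  sock_y0 : it_y r 0 = x0;
  sock_z0 : it_z r 0 = x0;
  sock_snap0 : it_snap r 0 = x0;
  sock_x : forall s j, (s < S)%N -> (j < m)%N -> let k := (s * m + j)%N in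
    it_x r k.+1 = tau1 *: it_z r k + tau2 *: it_snap r s
                  + (1 - tau1 - tau2) *: it_y r k;
  sock_z : forall s j, (s < S)%N -> (j < m)%N -> let k := (s * m + j)%N in
    let g := grad_est F G_ (a k) (b k) (it_x r k.+1) (it_snap r s) in
    is_minimizer (fun z => (dotp g z
        + (2 * alpha)^-1 * enorm (z - it_z r k) ^+ 2)%:E + h z)%E
      (it_z r k.+1);
  sock_y : forall s j, (s < S)%N -> (j < m)%N -> let k := (s * m + j)%N in
    let g := grad_est F G_ (a k) (b k) (it_x r k.+1) (it_snap r s) in
    is_minimizer (fun y => (dotp g y
        + 3 * L / 2 * enorm (y - it_x r k.+1) ^+ 2)%:E + h y)%E
      (it_y r k.+1);
  sock_snap : forall s, (s < S)%N ->
    it_snap r s.+1 = (\sum_(j < m) theta ^+ j)^-1 *: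
                     \sum_(j < m) theta ^+ j *: it_y r (s * m + j).+1
}.

Definition mutually_independent (d : measure_display) (T : measurableType d)
    (R : realType) (P : probability T R) (I : finType) (V : Type)
    (X : I -> T -> V) : Prop :=
  forall (J : {set I}) (E : I -> set V),
    P (\bigcap_(i in [set` J]) X i @^-1` E i)
    = (\prod_(i in J) P (X i @^-1` E i))%E.

(* The first clause says that the X i are random variables, 'I_n being
   discrete. *)
Definition iid_uniform (d : measure_display) (T : measurableType d)
    (R : realType) (P : probability T R) (I : finType) (n : nat)
    (X : I -> T -> 'I_n) : Prop :=
  [/\ forall i v, measurable (X i @^-1` [set v]),
      forall i v, P (X i @^-1` [set v]) = (n%:R^-1)%:E &
      mutually_independent P X].

(* All the draws of K iterations, as a single family of random indices. *)
Definition all_draws (T : Type) (n K A B : nat)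
    (a : nat -> 'I_A -> T -> 'I_n) (b : nat -> 'I_B -> T -> 'I_n)
    (i : 'I_K * ('I_A + 'I_B)) : T -> 'I_n :=
  match i.2 with inl u => a i.1 u | inr u => b i.1 u end.

(* Main.v *)
(* Write tau = 1/(2m), H u - H xstar = gap u and e for the error of the gradient
   estimate. One step of the method gives, pointwise in the draws,
     gap y+ <= tau gap xt + (1 - 2 tau) gap y
               + (3/2 tau^2 L + tau mu / 6) |z - xstar|^2
               - (3/2 tau^2 L + tau mu / 2) |z+ - xstar|^2 + 3 (tau / mu) |e|^2,
   which combines the optimality of the two proximal steps with the convexity
   and smoothness of f; the bias of the estimate is absorbed by Young's
   inequality into the strong convexity of h. Given the past, the Jacobian sample
   is independent of the sample of inner values, so the batch sizes give
   E |e|^2 <= mu^2 / 180 E |x - xt|^2, and strong convexity bounds |x - xt|^2 by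
   the gaps and by |z - xstar|^2; the net effect is to multiply the coefficients
   of the gaps by 1 + tau / 15. Weighting the steps of an epoch by the powers of
   theta = 1 + tau / 6 and telescoping, a potential decreases by the factor
   theta^m >= 13/12 per epoch.
   Since the proximal subproblems have unique minimizers, the trajectory is a
   function of finitely many uniform draws, and expectations are finite
   averages. *)

Require Import Defs.
From HB Require Import structures.
From mathcomp Require Import all_boot all_order all_algebra.
From mathcomp Require Import all_classical all_reals all_analysis.
From mathcomp Require Import measurable_realfun.
From mathcomp Require Import ring lra.

Import Order.TTheory GRing.Theory Num.Theory.
Import numFieldNormedType.Exports.

Local Open Scope classical_set_scope.
Local Open Scope ring_scope.

Set Implicit Arguments.
Unset Strict Implicit.
Unset Printing Implicit Defensive.

(** * Euclidean geometry and spectral norms *)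

Section euclidean.
Context {R : realType}.

Section dotp.
Context {N : nat}.
Implicit Types u v w : 'rV[R]_N.

Lemma dotpC u v : dotp u v = dotp v u.
Proof. by apply: eq_bigr => i _; rewrite mulrC. Qed.

Lemma dotpDl u v w : dotp (u + v) w = dotp u w + dotp v w.
Proof. by rewrite -big_split; apply: eq_bigr => i _; rewrite mxE mulrDl. Qed.

Lemma dotpDr u v w : dotp w (u + v) = dotp w u + dotp w v.
Proof. by rewrite dotpC dotpDl !(dotpC _ w). Qed.

Lemma dotpZl k u v : dotp (k *: u) v = k * dotp u v.
Proof. by rewrite mulr_sumr; apply: eq_bigr => i _; rewrite mxE mulrA. Qed.

Lemma dotpZr k u v : dotp u (k *: v) = k * dotp u v.
Proof. by rewrite dotpC dotpZl dotpC. Qed.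

Lemma dotpNl u v : dotp (- u) v = - dotp u v.
Proof. by rewrite -scaleN1r dotpZl mulN1r. Qed.

Lemma dotpNr u v : dotp u (- v) = - dotp u v.
Proof. by rewrite dotpC dotpNl dotpC. Qed.

Lemma dotpBl u v w : dotp (u - v) w = dotp u w - dotp v w.
Proof. by rewrite dotpDl dotpNl. Qed.

Lemma dotpBr u v w : dotp w (u - v) = dotp w u - dotp w v.
Proof. by rewrite dotpDr dotpNr. Qed.

Lemma dotp0l u : dotp 0 u = 0.
Proof. by rewrite -(scale0r 0) dotpZl mul0r. Qed.

Lemma dotp0r u : dotp u 0 = 0.
Proof. by rewrite dotpC dotp0l. Qed.

Lemma dotp_suml (I : Type) (r : seq I) (P : pred I) (V : I -> 'rV[R]_N) u :
  dotp (\sum_(i <- r | P i) V i) u = \sum_(i <- r | P i) dotp (V i) u.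
Proof.
by apply: (big_morph (fun v => dotp v u)) => [v w|]; rewrite ?dotpDl ?dotp0l.
Qed.

Lemma dotp_sumr (I : Type) (r : seq I) (P : pred I) (V : I -> 'rV[R]_N) u :
  dotp u (\sum_(i <- r | P i) V i) = \sum_(i <- r | P i) dotp u (V i).
Proof. by rewrite dotpC dotp_suml; apply: eq_bigr => i _; rewrite dotpC. Qed.

Lemma dotp_ge0 u : 0 <= dotp u u.
Proof. by apply: sumr_ge0 => i _; rewrite -expr2 sqr_ge0. Qed.

Lemma dotp_eq0 u : (dotp u u == 0) = (u == 0).
Proof.
apply/idP/eqP => [|->]; last by rewrite dotp0l.
rewrite psumr_eq0 => [/allP u0|i _]; last by rewrite -expr2 sqr_ge0.
apply/rowP => i; have := u0 i; rewrite mem_index_enum -expr2 sqrf_eq0 mxE.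
by move=> /(_ isT)/eqP.
Qed.

Lemma dotp_inj u v : (forall w, dotp u w = dotp v w) -> u = v.
Proof.
by move=> uv; apply/subr0_eq/eqP; rewrite -dotp_eq0 dotpBl uv subrr.
Qed.

Lemma enorm_sqr u : enorm u ^+ 2 = dotp u u.
Proof. by rewrite sqr_sqrtr ?dotp_ge0. Qed.

Lemma enorm_ge0 u : 0 <= enorm u. Proof. exact: sqrtr_ge0. Qed.

Lemma enorm0 : enorm (0 : 'rV[R]_N) = 0.
Proof. by rewrite /enorm dotp0l sqrtr0. Qed.

Lemma enorm_eq0 u : (enorm u == 0) = (u == 0).
Proof. by rewrite -sqrf_eq0 enorm_sqr dotp_eq0. Qed.

Lemma enormZ k u : enorm (k *: u) = `|k| * enorm u.
Proof.
rewrite /enorm dotpZl dotpZr mulrA -expr2 sqrtrM ?sqr_ge0 //.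
by rewrite sqrtr_sqr.
Qed.

Lemma cauchy_schwarz u v : dotp u v <= enorm u * enorm v.
Proof.
have [->|u0] := eqVneq u 0; first by rewrite dotp0l enorm0 mul0r.
have [->|v0] := eqVneq v 0; first by rewrite dotp0r enorm0 mulr0.
have a0 : 0 < enorm u by rewrite lt_def enorm_ge0 enorm_eq0 u0.
have b0 : 0 < enorm v by rewrite lt_def enorm_ge0 enorm_eq0 v0.
have := dotp_ge0 (enorm v *: u - enorm u *: v).
rewrite !dotpBl !dotpBr !dotpZl !dotpZr -!enorm_sqr (dotpC v u).
set a := enorm u in a0 *; set b := enorm v in b0 *; set c := dotp u v => h.
rewrite -(ler_pM2l (mulr_gt0 a0 b0)); lra.
Qed.

Lemma enormD u v : enorm (u + v) <= enorm u + enorm v.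
Proof.
rewrite -(@ler_pXn2r _ 2) ?nnegrE ?addr_ge0 ?enorm_ge0 //.
rewrite enorm_sqr dotpDl !dotpDr (dotpC v u) -!enorm_sqr.
have := cauchy_schwarz u v; lra.
Qed.

Lemma enorm_sum_le (I : Type) (r : seq I) (P : pred I) (V : I -> 'rV[R]_N) :
  enorm (\sum_(i <- r | P i) V i) <= \sum_(i <- r | P i) enorm (V i).
Proof.
apply: (big_ind2 (fun u x => enorm u <= x)) => [|u x v y ux vy|//].
  by rewrite enorm0.
exact: le_trans (enormD _ _) (lerD ux vy).
Qed.

Lemma sqr_enormD_le u v :
  dotp (u + v) (u + v) <= 2 * dotp u u + 2 * dotp v v.
Proof.
have := dotp_ge0 (u - v).
rewrite dotpBl !dotpBr dotpDl !dotpDr (dotpC v u); lra.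
Qed.

Lemma sqr_enormB_le u v :
  dotp (u - v) (u - v) <= 2 * dotp u u + 2 * dotp v v.
Proof. by have := sqr_enormD_le u (- v); rewrite (dotpNl v) dotpNr opprK. Qed.

Lemma young_dotp c u v : 0 < c ->
  dotp u v <= (2 * c)^-1 * dotp u u + c / 2 * dotp v v.
Proof.
move=> c0; have := dotp_ge0 (u - c *: v).
rewrite dotpBl !dotpBr !dotpZl !dotpZr (dotpC v u) => h.
rewrite -(ler_pM2l (mulr_gt0 (ltr0n _ 2) c0)).
rewrite mulrDr mulrA divff ?mulf_neq0 ?gt_eqF ?ltr0n //.
lra.
Qed.

Lemma enorm_le_sqr u x : enorm u <= x -> dotp u u <= x ^+ 2.
Proof.
move=> ux; rewrite -enorm_sqr ler_pXn2r ?nnegrE ?enorm_ge0 //.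
exact: le_trans (enorm_ge0 u) ux.
Qed.

(** Testing with [v = u] is enough. This dual form bounds a vector known only through its inner
    products, such as a transposed matrix applied to a vector or an increment of a map. *)
Lemma enorm_le_dotp u x : 0 <= x ->
  (forall v, dotp u v <= x * enorm v) -> enorm u <= x.
Proof.
move=> x0 /(_ u); rewrite -enorm_sqr expr2.
have [->|u0] := eqVneq u 0; first by rewrite enorm0.
by rewrite ler_pM2r // lt_def enorm_ge0 enorm_eq0 u0.
Qed.

End dotp.

Section mean.
Context {n : nat}.
Hypothesis n0 : (0 < n)%N.

Let n_neq0 : n%:R != 0 :> R. Proof. by rewrite pnatr_eq0 -lt0n. Qed.

Lemma mean_cst (V : lmodType R) (c : V) : mean (fun _ : 'I_n => c) = c.
Proof.
by rewrite /mean sumr_const card_ord -(scaler_nat n c) scalerA mulVf ?scale1r.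
Qed.

Lemma avgE (T : Type) (V : lmodType R) (phi : 'I_n -> T -> V) x :
  avg phi x = mean (fun i => phi i x).
Proof. by []. Qed.

Lemma meanB (V : lmodType R) (u v : 'I_n -> V) :
  mean (fun i => u i - v i) = mean u - mean v.
Proof. by rewrite /mean sumrB scalerBr. Qed.

Lemma enorm_mean_le N (u : 'I_n -> 'rV[R]_N) x :
  (forall i, enorm (u i) <= x) -> enorm (mean u) <= x.
Proof.
move=> ux; rewrite /mean enormZ ger0_norm ?invr_ge0 ?ler0n //.
rewrite ler_pdivrMl ?ltr0n //; apply: (le_trans (enorm_sum_le _ _ _)).
apply: (le_trans (ler_sum _ (fun i _ => ux i))).
by rewrite sumr_const card_ord mulr_natl.
Qed.

(** Variance is at most the second moment: centring at the mean c lowers the sum of squares by n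
    |c|^2. *)
Lemma sum_dotp_centered_le N (u : 'I_n -> 'rV[R]_N) :
  \sum_i dotp (u i - mean u) (u i - mean u) <= \sum_i dotp (u i) (u i).
Proof.
set c := mean u; have uc : \sum_i u i = n%:R *: c.
  by rewrite /c /mean scalerA divff ?scale1r.
move: c uc => c uc; rewrite (eq_bigr (fun i => dotp (u i) (u i) + (dotp c c - 2 * dotp (u i) c)));
  last by move=> i _; rewrite dotpBl !dotpBr (dotpC c); ring.
rewrite big_split /= sumrB -mulr_sumr -[\sum_i dotp (u i) c]dotp_suml uc dotpZl sumr_const card_ord.
rewrite -(mulr_natl (dotp c c) n) gerDl; have := mulr_ge0 (ler0n R n) (dotp_ge0 c).
by lra.
Qed.

End mean.

Section specnorm.
Context {p q : nat}.
Implicit Type M : 'M[R]_(p, q).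

Lemma dotp_trmul M (u : 'rV[R]_p) (v : 'rV[R]_q) :
  dotp (trmul M u) v = dotp u (v *m M^T).
Proof.
rewrite /dotp /trmul.
under eq_bigr do rewrite mxE mulr_suml.
under [RHS]eq_bigr do rewrite mxE mulr_sumr.
rewrite exchange_big; apply: eq_bigr => i _; apply: eq_bigr => j _.
by rewrite mxE mulrCA mulrC mulrA.
Qed.

Lemma trmulBl M M' (u : 'rV[R]_p) : trmul (M - M') u = trmul M u - trmul M' u.
Proof. exact: mulmxBr. Qed.

Lemma trmulBr M (u v : 'rV[R]_p) : trmul M (u - v) = trmul M u - trmul M v.
Proof. exact: mulmxBl. Qed.

Lemma trmulDl M M' (u : 'rV[R]_p) : trmul (M + M') u = trmul M u + trmul M' u.
Proof. exact: mulmxDr. Qed.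

Lemma trmul_meanl n (M : 'I_n -> 'M[R]_(p, q)) (u : 'rV[R]_p) :
  trmul (mean M) u = mean (fun i => trmul (M i) u).
Proof. by rewrite /trmul /mean -scalemxAr mulmx_sumr. Qed.

Lemma trmul_meanr n M (u : 'I_n -> 'rV[R]_p) :
  trmul M (mean u) = mean (fun i => trmul M (u i)).
Proof. by rewrite /trmul /mean -scalemxAl mulmx_suml. Qed.

(** The sum of the norms of the columns of M, a crude bound that makes the set in [specnorm] bounded
    above, so that its [sup] is a true supremum and not a default value. *)
Let frob M : R := \sum_j enorm (row j M^T).

Let frob_bound M (v : 'rV[R]_q) : enorm (v *m M^T) <= frob M * enorm v.
Proof.
rewrite mulmx_sum_row mulr_suml; apply: (le_trans (enorm_sum_le _ _ _)).
apply: ler_sum => j _; rewrite enormZ mulrC ler_wpM2l ?enorm_ge0 //.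
have vj : v 0 j = dotp v (delta_mx 0 j).
  rewrite /dotp (bigD1 j) //= mxE !eqxx mulr1 big1 ?addr0 // => i ij.
  by rewrite mxE (negbTE ij) andbF mulr0.
have dj : enorm (delta_mx 0 j : 'rV[R]_q) = 1.
  rewrite /enorm /dotp (bigD1 j) //= !mxE !eqxx mulr1 big1 ?addr0 ?sqrtr1 //.
  by move=> i ij; rewrite !mxE (negbTE ij) andbF mulr0.
rewrite ler_norml vj lerNl -dotpNl.
have nv : enorm (- v) = enorm v by rewrite -scaleN1r enormZ normrN1 mul1r.
apply/andP; split.
  by rewrite -nv -[leRHS]mulr1 -dj cauchy_schwarz.
by rewrite -[leRHS]mulr1 -dj cauchy_schwarz.
Qed.

Let specnorm_has_sup M : has_sup
  [set enorm (v *m M^T) | v in [set v : 'rV[R]_q | enorm v <= 1]].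
Proof.
split; first by exists (enorm (0 *m M^T)); exists 0 => //=; rewrite enorm0.
exists (frob M) => _ [v /= v1 <-]; apply: (le_trans (frob_bound M v)).
by rewrite ler_piMr // sumr_ge0 // => j _; exact: enorm_ge0.
Qed.

Lemma specnorm_ge0 M : 0 <= specnorm M.
Proof.
have := sup_upper_bound (specnorm_has_sup M) => /(_ (enorm (0 *m M^T))).
by rewrite mul0mx enorm0; apply; exists 0; rewrite /= ?enorm0 ?mul0mx ?enorm0.
Qed.

Lemma enorm_mulmx_le M (v : 'rV[R]_q) :
  enorm (v *m M^T) <= specnorm M * enorm v.
Proof.
have [->|v0] := eqVneq v 0; first by rewrite mul0mx !enorm0 mulr0.
have a0 : 0 < enorm v by rewrite lt_def enorm_ge0 enorm_eq0 v0.
rewrite -ler_pdivrMr // mulrC.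
have -> : (enorm v)^-1 * enorm (v *m M^T) = enorm (((enorm v)^-1 *: v) *m M^T).
  by rewrite -scalemxAl enormZ ger0_norm ?invr_ge0 ?enorm_ge0.
apply: (sup_upper_bound (specnorm_has_sup M)).
exists ((enorm v)^-1 *: v) => //=.
by rewrite enormZ ger0_norm ?invr_ge0 ?enorm_ge0 // mulVf ?gt_eqF.
Qed.

(** A matrix and its transpose obey the same bound by duality: pair with v and move M across the
    inner product. *)
Lemma enorm_trmul_le M (u : 'rV[R]_p) :
  enorm (trmul M u) <= specnorm M * enorm u.
Proof.
apply: enorm_le_dotp; first by rewrite mulr_ge0 ?specnorm_ge0 ?enorm_ge0.
move=> v; rewrite dotp_trmul (le_trans (cauchy_schwarz _ _)) //.
by rewrite [leRHS]mulrAC [leRHS]mulrC ler_wpM2l ?enorm_ge0 ?enorm_mulmx_le.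
Qed.

End specnorm.

End euclidean.

(** * Differential calculus *)

Section calculus.
Context {R : realType}.

Lemma dotp_grad N (phi : 'rV[R]_N -> R^o) x v : differentiable phi x ->
  dotp (grad phi x) v = 'd phi x v.
Proof.
move=> dphi; rewrite {2}(row_sum_delta v) linear_sum.
by apply: eq_bigr => i _; rewrite linearZ mxE deriveE // mulrC.
Qed.

Lemma dotp_trmul_jac N M (g : 'rV[R]_N -> 'rV[R]_M) x u v :
  differentiable g x -> dotp (trmul (jac g x) u) v = dotp u ('d g x v).
Proof.
by move=> dg; rewrite dotp_trmul trmxK -deriveEjacobian // deriveE.
Qed.

Lemma is_diff_avg n N (V : normedModType R) (phi : 'I_n -> 'rV[R]_N -> V) x :
  (forall i, differentiable (phi i) x) ->
  is_diff x (avg phi : 'rV[R]_N -> V)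
    (fun v => mean (fun i => 'd (phi i) x v)).
Proof.
move=> dphi.
have -> : avg phi = n%:R^-1 *: \sum_(i < n) phi i.
  by apply/funext => y; rewrite /avg /mean /= fct_sumE.
have -> : (fun v => mean (fun i => 'd (phi i) x v)) =
          n%:R^-1 *: \sum_(i < n) ('d (phi i) x : 'rV[R]_N -> V).
  by apply/funext => y; rewrite /mean /= fct_sumE.
apply: is_diffZ.
apply: (big_ind2 (fun f df => is_diff x f df)) => [|f df g dg ? ?|i _].
- exact: is_diff_cst.
- exact: is_diffD.
- exact: differentiableP.
Qed.

Lemma grad_avg n N (phi : 'I_n -> 'rV[R]_N -> R^o) x :
  (forall i, differentiable (phi i) x) ->
  grad (avg phi) x = mean (fun i => grad (phi i) x).
Proof.
move=> dphi; have dav := is_diff_avg dphi.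
apply: dotp_inj => v; rewrite dotp_grad; last exact: ex_diff.
rewrite diff_val /mean dotpZl dotp_suml; congr (_ * _).
by apply: eq_bigr => i _; rewrite dotp_grad.
Qed.

Lemma trmul_jac_avg n N M (g : 'I_n -> 'rV[R]_N -> 'rV[R]_M) x u :
  (forall i, differentiable (g i) x) ->
  trmul (jac (avg g) x) u = mean (fun i => trmul (jac (g i) x) u).
Proof.
move=> dg; have dav := is_diff_avg dg.
apply: dotp_inj => v; rewrite dotp_trmul_jac; last exact: ex_diff.
rewrite diff_val /mean dotpZl dotpZr dotp_suml dotp_sumr; congr (_ * _).
by apply: eq_bigr => i _; rewrite dotp_trmul_jac.
Qed.

Lemma grad_comp N M (phi : 'rV[R]_M -> R^o) (g : 'rV[R]_N -> 'rV[R]_M) x :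
  differentiable g x -> differentiable phi (g x) ->
  grad (phi \o g) x = trmul (jac g x) (grad phi (g x)).
Proof.
move=> dg dphi; apply: dotp_inj => v.
rewrite dotp_trmul_jac // !dotp_grad //; last exact: differentiable_comp.
by rewrite diff_comp.
Qed.

Section line.
Context {N : nat}.
Variables (phi : 'rV[R]_N -> R^o) (x d : 'rV[R]_N).
Hypothesis dphi : forall y, differentiable phi y.

Lemma is_derive_line (t : R) :
  is_derive t 1 (fun s : R => phi (x + s *: d) : R)
    (dotp (grad phi (x + t *: d)) d).
Proof.
have dl : is_diff t (fun s : R => x + s *: d) (fun s : R => s *: d).
  have -> : (fun s : R => s *: d) = cst 0 + (fun s : R => s *: d).
    by apply/funext => s; rewrite /= fctE add0r.
  apply: is_diffD; apply: is_diff_scalel.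
have dc : is_diff t (phi \o (fun s : R => x + s *: d))
            ('d phi (x + t *: d) \o (fun s : R => s *: d)).
  exact: is_diff_comp.
split; first by apply/derivable1_diffP; exact: ex_diff.
by rewrite deriveE ?diff_val /= ?scale1r ?dotp_grad //; exact: ex_diff.
Qed.

Lemma MVT_line : exists2 c, 0 < c < 1 &
  phi (x + d) - phi x = dotp (grad phi (x + c *: d)) d.
Proof.
have [||c] := @MVT R (fun s => phi (x + s *: d))
  (fun s => dotp (grad phi (x + s *: d)) d) 0 1 ltr01.
- by move=> t _; exact: is_derive_line.
- apply: derivable_within_continuous => t _.
  exact: (@ex_derive _ _ _ _ _ _ _ (is_derive_line t)).
by rewrite in_itv /= scale1r scale0r addr0 subr0 mulr1; exists c.
Qed.

End line.

End calculus.

(** * Smooth convex functions and Lipschitz maps *)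

Section smooth_convex.
Context {R : realType}.

(** Stands in for dividing by t and letting t tend to 0 in first-order arguments. *)
Lemma quadratic_ge0_lin (a b : R) :
  (forall t, 0 < t <= 1 -> 0 <= t * a + t ^+ 2 * b) -> 0 <= a.
Proof.
move=> ab; rewrite leNgt; apply/negP => a0.
have b0 : 0 < b by have := ab 1; rewrite ltr01 lexx => /(_ isT); lra.
have c0 : 0 < - a / (2 * b) by rewrite divr_gt0 ?oppr_gt0 ?mulr_gt0.
(* At this t one has t b <= - a / 2, so a < 0 would make a + t b negative; the minimum with 1 keeps
   t in the allowed range. *)
pose t := Num.min 1 (- a / (2 * b)).
have t0 : 0 < t by rewrite lt_min ltr01.
have := ab t; rewrite t0 ge_min lexx => /(_ isT).
rewrite expr2 -mulrA -mulrDr pmulr_rge0 //.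
have : t * b <= - a / (2 * b) * b by rewrite ler_wpM2r ?ge_min ?lexx ?orbT ?ltW.
rewrite -mulrA invfM mulrVK ?unitfE ?gt_eqF //; lra.
Qed.

Lemma convex_functionE N (phi : 'rV[R]_N -> R^o) x y (t : R) :
  @convex_function R 'rV[R]_N setT phi -> 0 <= t <= 1 ->
  phi (t *: x + (1 - t) *: y) <= t * phi x + (1 - t) * phi y.
Proof.
move=> cvx /andP[t0 t1].
by have := cvx (Itv01 t0 t1) x y (mem_setT _) (mem_setT _).
Qed.

Section smooth.
Context {N : nat}.
Variables (phi : 'rV[R]_N -> R^o) (L : R).
Hypothesis dphi : forall y, differentiable phi y.
Hypothesis phiL : forall x y,
  enorm (grad phi x - grad phi y) <= L * enorm (x - y).
Hypothesis L0 : 0 <= L.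

(** The mean value theorem takes the gradient at an intermediate point of the segment, which gives
    the constant L instead of the sharp L / 2. The weight 3 L / 2 of the y-step has room for it: L
    here and L / 2 for the gradient error. *)
Lemma taylor1_bound x d :
  `|phi (x + d) - phi x - dotp (grad phi x) d| <= L * dotp d d.
Proof.
have [c /andP[c0 c1] ->] := MVT_line x d dphi; rewrite -dotpBl.
set e := grad phi _ - _.
have ed : enorm e * enorm d <= L * dotp d d.
  rewrite -enorm_sqr expr2 mulrA ler_wpM2r ?enorm_ge0 //.
  apply: (le_trans (phiL _ _)); rewrite addrC addKr enormZ gtr0_norm //.
  by rewrite ler_wpM2l // ler_piMl ?enorm_ge0 ?ltW.
rewrite ler_norml lerNl -dotpNl; apply/andP; split; apply: le_trans ed.
  by rewrite (le_trans (cauchy_schwarz _ _)) // -scaleN1r enormZ normrN1 mul1r.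
exact: cauchy_schwarz.
Qed.

Lemma smooth_le x y : phi y <= phi x + dotp (grad phi x) (y - x)
                                 + L * dotp (y - x) (y - x).
Proof.
have := taylor1_bound x (y - x); rewrite subrKC ler_norml => /andP[_]; lra.
Qed.

Lemma convex_grad_ge x y : @convex_function R 'rV[R]_N setT phi ->
  phi x + dotp (grad phi x) (y - x) <= phi y.
Proof.
move=> cvx; rewrite -subr_ge0; set a := (X in 0 <= X).
apply: (@quadratic_ge0_lin a (L * dotp (y - x) (y - x))) => t /andP[t0 t1].
have := convex_functionE y x cvx; move=> /(_ t); rewrite (ltW t0) t1 => /(_ isT).
have -> : t *: y + (1 - t) *: x = x + t *: (y - x).
  by rewrite scalerBl scale1r scalerBr addrCA addrA addrAC.
have := taylor1_bound x (t *: (y - x)); rewrite ler_norml => /andP[+ _].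
by rewrite !dotpZr dotpZl /a; nra.
Qed.

End smooth.

Lemma dotp_linear N (u : 'rV[R]_N) : linear (dotp u : 'rV[R]_N -> R^o).
Proof. by move=> k v w; rewrite dotpDr dotpZr. Qed.

HB.instance Definition _ N (u : 'rV[R]_N) :=
  GRing.isLinear.Build R 'rV[R]_N R^o _ (dotp u : 'rV[R]_N -> R^o)
    (@dotp_linear N u).

Lemma is_diff_dotp N (u w : 'rV[R]_N) :
  is_diff w (dotp u : 'rV[R]_N -> R^o) (dotp u).
Proof.
have df x : differentiable (dotp u : 'rV[R]_N -> R^o) x.
  have -> : dotp u = \sum_i (u 0 i *: (fun v : 'rV[R]_N => v 0 i : R^o)).
    by apply/funext => v; rewrite fct_sumE.
  apply: differentiable_sum => i; apply: differentiableZ.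
  exact: differentiable_coord.
apply: DiffDef => //; rewrite diff_lin // => x.
exact: differentiable_continuous.
Qed.

(** The mean value theorem is scalar, so it is applied to [dotp u \o g] for each u, and duality
    recovers the norm of the increment. *)
Lemma lipschitz_map N M (g : 'rV[R]_N -> 'rV[R]_M) b x y :
  (forall z, differentiable g z) -> (forall z, specnorm (jac g z) <= b) ->
  enorm (g x - g y) <= b * enorm (x - y).
Proof.
move=> dg gb; have b0 : 0 <= b := le_trans (specnorm_ge0 _) (gb 0).
apply: enorm_le_dotp => [|u]; first by rewrite mulr_ge0 ?enorm_ge0.
have dug z : differentiable ((dotp u : _ -> R^o) \o g) z.
  by apply: differentiable_comp => //; have dd := is_diff_dotp u (g z); apply: ex_diff.
have [c _] := MVT_line y (x - y) dug; rewrite subrKC /= -dotpBr dotpC => ->.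
set z := y + _; have dd := is_diff_dotp u (g z).
rewrite dotp_grad // diff_comp //=.
rewrite diff_val -dotp_trmul_jac //.
rewrite (le_trans (cauchy_schwarz _ _)) // mulrAC ler_wpM2r ?enorm_ge0 //.
by rewrite (le_trans (enorm_trmul_le _ _)) // ler_wpM2r ?enorm_ge0.
Qed.

End smooth_convex.

(** * Finite averages over independent uniform draws *)

Section resampling.
Context {I X : finType}.
Implicit Types (w : {ffun I -> X}) (i j : I) (v : X).

(** Resampling of one draw. Independence of a quantity from draw i is expressed as invariance under
    [upd _ i _], which replaces conditional expectations. *)
Definition upd w i v : {ffun I -> X} := [ffun j => if j == i then v else w j].

Lemma upd_eq w i v : upd w i v i = v.
Proof. by rewrite ffunE eqxx. Qed.

Lemma upd_neq w i v j : j != i -> upd w i v j = w j.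
Proof. by rewrite ffunE => /negbTE->. Qed.

(* (w, v) |-> (w with w i replaced by v, w i) is an involution. *)
Lemma sum_resample (V : nmodType) (Phi : {ffun I -> X} -> V) i :
  \sum_w \sum_v Phi (upd w i v) = (\sum_w Phi w) *+ #|X|.
Proof.
pose s (p : {ffun I -> X} * X) := (upd p.1 i p.2, p.1 i).
have sK : involutive s.
  move=> [w v]; rewrite /s /= upd_eq; congr pair.
  by apply/ffunP => j; rewrite !ffunE; case: eqP => // ->.
rewrite pair_big /= (reindex_inj (inv_inj sK)) /=.
rewrite (eq_bigr (fun p => Phi p.1)) => [|[w v] _ /=]; last first.
  by congr Phi; have [] := sK (w, v).
rewrite -(pair_big xpredT xpredT (fun w _ => Phi w)) /= -sumrMnl.
by apply: eq_bigr => w _; rewrite sumr_const cardE.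
Qed.

End resampling.

(** * The variance of a sample mean *)

Section variance.
Context {R : realType} {I : finType} {n A N : nat}.
Hypotheses (n0 : (0 < n)%N) (A0 : (0 < A)%N).
Let Omega := {ffun I -> 'I_n}.
Variables (e : 'I_A -> I) (Y : Omega -> 'I_n -> 'rV[R]_N) (C : Omega -> R).
Hypothesis e_inj : injective e.
Hypothesis Y_upd : forall w i v, Y (upd w (e i) v) = Y w.
Hypothesis YC : forall w v, dotp (Y w v) (Y w v) <= C w.

Let Z w v := Y w v - mean (Y w).

Let Z_upd w i v : Z (upd w (e i) v) = Z w.
Proof. by rewrite /Z Y_upd. Qed.

Let sumZ w : \sum_v Z w v = 0.
Proof.
rewrite sumrB sumr_const card_ord -(scaler_nat n) scalerA.
by rewrite mulfV ?scale1r ?subrr // pnatr_eq0 -lt0n.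
Qed.

Let nR0 : 0 < n%:R :> R. Proof. by rewrite ltr0n. Qed.

(** Expand the square of the centred mean into A^2 terms. The off-diagonal ones vanish and each of
    the A diagonal ones is at most the second moment, which leaves the factor 1 / A. *)
Lemma variance_sample_mean :
  \sum_w (let d := mean (fun i => Y w (w (e i))) - mean (Y w) in dotp d d)
  <= A%:R^-1 * \sum_w C w.
Proof.
(* Resampling draw [e i] alone fixes both [Z w] and draw [e j], and the centred values sum to 0. *)
have cross i j : i != j ->
    \sum_(w : Omega) dotp (Z w (w (e i))) (Z w (w (e j))) = 0.
  move=> ij; apply/eqP; rewrite -(mulrI_eq0 _ (mulfI (lt0r_neq0 nR0))).
  rewrite mulr_natl -[X in _ *+ X](card_ord n) -(sum_resample _ (e i)).
  apply/eqP/big1 => w _.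
  under eq_bigr do rewrite Z_upd upd_eq upd_neq ?(inj_eq e_inj) 1?eq_sym //.
  by rewrite -dotp_suml sumZ dotp0l.
have diag i : \sum_(w : Omega) dotp (Z w (w (e i))) (Z w (w (e i)))
              <= \sum_w C w.
  rewrite -(ler_pM2l nR0) mulr_natl -[X in _ *+ X](card_ord n).
  rewrite -(sum_resample _ (e i)) mulr_sumr; apply: ler_sum => w _.
  under eq_bigr do rewrite Z_upd upd_eq.
  apply: (le_trans (sum_dotp_centered_le n0 (Y w))).
  apply: (le_trans (ler_sum _ (fun v _ => YC w v))).
  by rewrite sumr_const card_ord mulr_natl.
have -> : \sum_w (let d := mean (fun i => Y w (w (e i))) - mean (Y w) in
                  dotp d d)
    = A%:R^-1 * (A%:R^-1 * \sum_i \sum_j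
        \sum_(w : Omega) dotp (Z w (w (e i))) (Z w (w (e j)))).
  rewrite (eq_bigr (fun i => \sum_(w : Omega) \sum_j
    dotp (Z w (w (e i))) (Z w (w (e j))))) => [|i _]; last exact: exchange_big.
  rewrite [X in _ = _ * (_ * X)]exchange_big /= !mulr_sumr.
  apply: eq_bigr => w _ /=.
  rewrite -[X in _ - X](mean_cst A0) -meanB.
  rewrite /mean dotpZl dotpZr dotp_suml; congr (_ * (_ * _)).
  by apply: eq_bigr => i _; rewrite dotp_sumr.
rewrite ler_wpM2l ?invr_ge0 ?ler0n // ler_pdivrMl ?ltr0n //.
rewrite (eq_bigr (fun i => \sum_(w : Omega) dotp (Z w (w (e i))) (Z w (w (e i))))).
  apply: (le_trans (ler_sum _ (fun i _ => diag i))).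
  by rewrite sumr_const card_ord mulr_natl.
move=> i _; rewrite (bigD1 i) //= [X in _ + X]big1 ?addr0 // => j ji.
by rewrite cross // eq_sym.
Qed.

End variance.

(** * The compositional gradient and the variance of its estimate *)

Section compositional.
Context {R : realType} {N1 N2 n1 n2 : nat}.
Variables (F_ : 'I_n1 -> 'rV[R]_N1 -> R^o).
Variables (G_ : 'I_n2 -> 'rV[R]_N2 -> 'rV[R]_N1).
Variables (LF BF LG BG L : R).
Hypotheses (n1_gt0 : (0 < n1)%N) (n2_gt0 : (0 < n2)%N).
Hypothesis F_smooth : forall i, smooth_fun LF (F_ i).
Hypothesis F_bounded : forall i x, enorm (grad (F_ i) x) <= BF.
Hypothesis G_smooth : forall j, smooth_map LG (G_ j).
Hypothesis G_bounded : forall j x, specnorm (jac (G_ j) x) <= BG.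

Local Notation F := (avg F_).
Local Notation G := (avg G_).
Local Notation f := (avg F_ \o avg G_ : 'rV[R]_N2 -> R^o).

Let dF_ i x : differentiable (F_ i) x. Proof. by have [] := F_smooth i. Qed.
Let dG_ j x : differentiable (G_ j) x. Proof. by have [] := G_smooth j. Qed.
Let dF x : differentiable (F : _ -> R^o) x.
Proof. by have dF := is_diff_avg (fun i => dF_ i x); exact: ex_diff. Qed.
Let dG x : differentiable (G : _ -> 'rV[R]_N1) x.
Proof. by have dG := is_diff_avg (fun i => dG_ i x); exact: ex_diff. Qed.

Lemma differentiable_compositional x : differentiable f x.
Proof. exact: differentiable_comp. Qed.

Lemma grad_compositional x : grad f x = trmul (jac G x) (grad F (G x)).
Proof. exact: grad_comp. Qed.

Lemma grad_avg_lipschitz u v :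
  enorm (grad (F : _ -> R^o) u - grad (F : _ -> R^o) v) <= LF * enorm (u - v).
Proof.
rewrite (grad_avg (dF_^~ u)) (grad_avg (dF_^~ v)) -meanB.
apply: (enorm_mean_le n1_gt0) => i.
by have [_ +] := F_smooth i; exact.
Qed.

Lemma grad_avg_bounded u : enorm (grad (F : _ -> R^o) u) <= BF.
Proof. by rewrite (grad_avg (dF_^~ u)); exact: (enorm_mean_le n1_gt0). Qed.

Lemma trmul_jac_avg_bounded x u :
  enorm (trmul (jac G x) u) <= BG * enorm u.
Proof.
rewrite (trmul_jac_avg u (dG_^~ x)); apply: (enorm_mean_le n2_gt0) => j.
apply: (le_trans (enorm_trmul_le _ _)).
by rewrite ler_wpM2r ?enorm_ge0.
Qed.

(** The gradient of f is the average over i and j of the vectors in the hypothesis, and averaging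
    preserves a Lipschitz bound. *)
Lemma grad_compositional_lipschitz x y :
  (forall i j x y,
     enorm (trmul (jac (G_ j) x) (grad (F_ i) (G x))
            - trmul (jac (G_ j) y) (grad (F_ i) (G y))) <= L * enorm (x - y)) ->
  enorm (grad f x - grad f y) <= L * enorm (x - y).
Proof.
move=> fL.
have gradE z : grad f z = mean (fun j => mean (fun i =>
    trmul (jac (G_ j) z) (grad (F_ i) (G z)))).
  apply: (etrans (grad_compositional z)).
  apply: (etrans (trmul_jac_avg _ (dG_^~ z))).
  congr mean.
  apply/funext => j.
  by rewrite (grad_avg (dF_^~ (G z))) trmul_meanr.
rewrite (gradE x) (gradE y) -meanB; apply: (enorm_mean_le n2_gt0) => j.
rewrite -meanB; apply: (enorm_mean_le n1_gt0) => i.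
exact: fL.
Qed.

Section estimator.
Context {I : finType} {A B : nat}.
Hypotheses (A_gt0 : (0 < A)%N) (B_gt0 : (0 < B)%N).
Let Omega := {ffun I -> 'I_n2}.
Variables (ea : 'I_A -> I) (eb : 'I_B -> I) (x xt : Omega -> 'rV[R]_N2).
Hypotheses (ea_inj : injective ea) (eb_inj : injective eb).
Hypothesis ea_eb : forall i j, ea i != eb j.
Hypotheses (x_a : forall w i v, x (upd w (ea i) v) = x w)
  (xt_a : forall w i v, xt (upd w (ea i) v) = xt w)
  (x_b : forall w i v, x (upd w (eb i) v) = x w)
  (xt_b : forall w i v, xt (upd w (eb i) v) = xt w).

Let d w := dotp (x w - xt w) (x w - xt w).

Let sqr_bound (w : Omega) N (u : 'rV[R]_N) c :
  enorm u <= c * enorm (x w - xt w) -> dotp u u <= c ^+ 2 * d w.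
Proof. by move=> /enorm_le_sqr; rewrite exprMn enorm_sqr. Qed.

(* The Jacobian sample is independent of [hatG], so conditionally on the latter
   the matrix error is applied to a fixed vector: only Euclidean, not spectral,
   variances are involved. *)
Lemma grad_est_variance :
  \sum_(w : Omega)
    (let e := grad_est (F : _ -> R^o) G_ (w \o ea) (w \o eb) (x w) (xt w)
              - grad f (x w) in dotp e e)
  <= (2 * (BF ^+ 2 * LG ^+ 2 / B%:R) + 2 * (BG ^+ 4 * LF ^+ 2 / A%:R))
     * \sum_w d w.
Proof.
pose Ya (w : Omega) v := G_ v (x w) - G_ v (xt w).
pose gF (w : Omega) := grad (F : _ -> R^o) (hatG G_ (w \o ea) (x w) (xt w)).
pose Yb (w : Omega) v := trmul (jac (G_ v) (x w) - jac (G_ v) (xt w)) (gF w).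
pose ra (w : Omega) := mean (fun i => Ya w (w (ea i))) - mean (Ya w).
pose rb (w : Omega) := mean (fun i => Yb w (w (eb i))) - mean (Yb w).
have Ea : \sum_w dotp (ra w) (ra w) <= A%:R^-1 * \sum_w (BG ^+ 2 * d w).
  apply: (variance_sample_mean n2_gt0 A_gt0 ea_inj) => [w i v|w v].
    by rewrite /Ya x_a xt_a.
  by apply: sqr_bound; exact: lipschitz_map.
(* The vector [gF w] is random, but it depends only on the [ea] draws; resampling an [eb] draw
   leaves it fixed because the two index families are disjoint. *)
have Eb : \sum_w dotp (rb w) (rb w) <=
          B%:R^-1 * \sum_w ((BF * LG) ^+ 2 * d w).
  apply: (variance_sample_mean n2_gt0 B_gt0 eb_inj) => [w i v|w v].
    rewrite /Yb /gF /hatG x_b xt_b; apply/funext => v'; do 3 congr (_ _).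
    by congr (mean _ + _); apply/funext => j /=; rewrite upd_neq.
  apply: sqr_bound; apply: (le_trans (enorm_trmul_le _ _)).
  rewrite mulrC -mulrA ler_pM ?enorm_ge0 ?specnorm_ge0 ?grad_avg_bounded //.
  by have [_ +] := G_smooth v; exact.
have raE w : ra w = hatG G_ (w \o ea) (x w) (xt w) - G (x w).
  by rewrite /ra /hatG /Ya [X in _ - X]meanB -!avgE opprB addrA.
have EJ z u := trmul_jac_avg u (dG_^~ z).
have rbE w : rb w = trmul (hat_jacG G_ (w \o eb) (x w) (xt w)) (gF w)
                    - trmul (jac G (x w)) (gF w).
  have -> : rb w = mean (fun i => Yb w (w (eb i)))
      - (trmul (jac G (x w)) (gF w) - trmul (jac G (xt w)) (gF w)).
    congr (_ - _); apply: (etrans _ (esym (congr2 (fun u v => u - v)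
      (EJ (x w) (gF w)) (EJ (xt w) (gF w))))).
    rewrite -meanB; congr mean; apply/funext => v; exact: trmulBl.
  rewrite opprB addrA; congr (_ - _).
  by rewrite /hat_jacG trmulDl trmul_meanl.
have BG0 : 0 <= BG := le_trans (specnorm_ge0 _) (G_bounded (Ordinal n2_gt0) 0).
apply: (@le_trans _ _ (\sum_(w : Omega) (2 * dotp (rb w) (rb w)
    + 2 * ((BG * LF) ^+ 2 * dotp (ra w) (ra w))))).
  apply: ler_sum => w _ /=; set e := _ - _.
  (* The error splits into [rb], the Jacobian sampling error applied to [gF], and s, the exact
     Jacobian applied to the error that [hatG] causes in the gradient of F. *)
  pose s := trmul (jac G (x w)) (gF w - grad (F : _ -> R^o) (G (x w))).
  have -> : e = rb w + s.
    by rewrite rbE /s trmulBr addrA subrK /e grad_compositional.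
  apply: (le_trans (sqr_enormD_le _ _)); rewrite lerD2l ler_pM2l //.
  have : enorm s <= BG * LF * enorm (ra w).
    apply: (le_trans (trmul_jac_avg_bounded _ _)).
    by rewrite -mulrA ler_wpM2l // raE; exact: grad_avg_lipschitz.
  by move=> /enorm_le_sqr; rewrite exprMn enorm_sqr.
rewrite big_split /= -!mulr_sumr in Ea Eb *.
rewrite [leRHS]mulrDl; apply: lerD; rewrite -[leRHS]mulrA ler_pM2l //.
  by apply: (le_trans Eb); rewrite exprMn mulrCA !mulrA.
apply: (le_trans (ler_wpM2l (sqr_ge0 (BG * LF)) Ea)).
by rewrite le_eqVlt; apply/orP; left; apply/eqP; ring.
Qed.

End estimator.
End compositional.

(** * Expectations over uniform draws as finite averages *)

Section uniform_draws.
Context {d : measure_display} {T : measurableType d} {R : realType}.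
Variables (P : probability T R) (I : finType) (n : nat).
Variable X : I -> T -> 'I_n.
Hypotheses (n_gt0 : (0 < n)%N) (X_iid : iid_uniform P X).

(** The events that prescribe every draw; they partition the space. The intersection runs over the
    full finite set so that mutual independence applies to the whole family. *)
Let atom (w : {ffun I -> 'I_n}) : set T :=
  \bigcap_(i in [set` [set: I]%SET]) X i @^-1` [set w i].

Let in_atom w t : atom w t <-> w = [ffun i => X i t].
Proof.
split => [wt|-> i _ /=]; last by rewrite ffunE.
by apply/ffunP => i; rewrite ffunE; apply/esym/wt; rewrite /= inE.
Qed.

Let measurable_atom w : measurable (atom w).
Proof.
have [mX _ _] := X_iid.
by apply: fin_bigcap_measurable => // i _; exact: mX.
Qed.

Let P_atom w : P (atom w) = (n%:R^-1 ^+ #|I|)%:E.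
Proof.
have [_ PX] := X_iid; move=> /(_ [set: I]%SET (fun i => [set w i])) ->.
rewrite (eq_bigr (fun=> (n%:R^-1)%:E)) => [|i _]; last exact: PX.
by rewrite prodEFin prodr_const cardsT.
Qed.

(** Each atom has positive probability, hence is inhabited. This supplies a sample point for every
    outcome of the draws. *)
Lemma draws_attained (w : {ffun I -> 'I_n}) : exists t, forall i, X i t = w i.
Proof.
have /set0P[t wt] : atom w != set0.
  apply/eqP => w0; have := P_atom w; rewrite w0 measure0 => /eqP.
  by rewrite eqe eq_sym expf_eq0 invr_eq0 pnatr_eq0 gtn_eqF ?andbF.
by exists t => i; apply: wt; rewrite /= inE.
Qed.

(** The integrand is a finite combination of indicators of atoms, all of the same mass. *)
Lemma integral_draws (psi : {ffun I -> 'I_n} -> R) : (forall w, 0 <= psi w) ->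
  (\int[P]_t (psi [ffun i => X i t])%:E
   = (n%:R^-1 ^+ #|I| * \sum_w psi w)%:E)%E.
Proof.
move=> psi0.
have psiE t : (psi [ffun i => X i t])%:E =
    (\sum_(w : {ffun I -> 'I_n}) (psi w * \1_(atom w) t)%:E)%E.
  rewrite sumEFin (bigD1 [ffun i => X i t]) //= big1 => [|w wt].
    by rewrite indicE mem_set ?mulr1 ?addr0 //; apply/in_atom.
  rewrite indicE memNset ?mulr0 // => /in_atom wE.
  by rewrite wE eqxx in wt.
under eq_integral do rewrite psiE.
rewrite ge0_integral_sum //; last 2 first.
- by move=> w; apply/measurable_EFinP; apply: measurable_funM.
- by move=> w t _; rewrite lee_fin mulr_ge0.
rewrite mulr_sumr -sumEFin; apply: eq_bigr => w _.
rewrite (@integralZl_indic _ _ _ P setT _ (fun=> atom w)) //; last first.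
  by rewrite ltNge psi0.
by rewrite integral_indic // setIT [X in (_ * X)%E]P_atom -EFinM mulrC.
Qed.

End uniform_draws.

(** * Convex functions with extended values *)

Section extended_convex.
Context {R : realType} {N : nat}.
Variable h : 'rV[R]_N -> \bar R.
Hypothesis h_pcc : proper_closed_convex h.
Implicit Types u v x y z : 'rV[R]_N.

Lemma proper_fineK u : (h u < +oo)%E -> h u = (fine (h u))%:E.
Proof.
move=> hu; rewrite fineK // fin_numE -ltey hu andbT.
by have [[hN _] _ _] := h_pcc; exact: hN.
Qed.

Lemma dom_convex u v t : (h u < +oo)%E -> (h v < +oo)%E -> 0 <= t <= 1 ->
  (h (t *: u + (1 - t) *: v) < +oo)%E /\
  fine (h (t *: u + (1 - t) *: v)) <= t * fine (h u) + (1 - t) * fine (h v).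
Proof.
move=> hu hv t01; have [_ _ /(_ u v t t01)] := h_pcc.
rewrite (proper_fineK hu) (proper_fineK hv) -!EFinM -EFinD => huv.
have huv_oo : (h (t *: u + (1 - t) *: v) < +oo)%E.
  by apply: (le_lt_trans huv); rewrite ltry.
by split => //; rewrite (proper_fineK huv_oo) lee_fin in huv.
Qed.

Section minimizer.
Variables (q : 'rV[R]_N -> R) (z : 'rV[R]_N).
Hypothesis z_min : is_minimizer (fun u => (q u)%:E + h u)%E z.

Lemma minimizer_dom u : (h u < +oo)%E -> (h z < +oo)%E.
Proof.
move=> hu; have := z_min u; rewrite (proper_fineK hu) => zu.
have [hz|//] := leP +oo%E (h z).
by move: zu; rewrite leye_eq in hz; rewrite (eqP hz) addey // leNgt ltry.
Qed.

Lemma minimizer_fine_le u : (h u < +oo)%E ->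
  q z + fine (h z) <= q u + fine (h u).
Proof.
move=> hu; have hz := minimizer_dom hu; have := z_min u.
by rewrite (proper_fineK hu) (proper_fineK hz) -!EFinD lee_fin.
Qed.

(* [- p] is a subgradient of [h] at [z]: let t tend to 0 along segments. Only a
   quadratic upper model of [q] at [z], with slope [p], is needed. *)
Lemma minimizer_strong_growth mu p u : (h u < +oo)%E -> strongly_convex mu h ->
  (forall v, exists b, forall t, 0 < t <= 1 ->
    q (z + t *: (v - z)) <= q z + t * dotp p (v - z) + t ^+ 2 * b) ->
  fine (h z) - dotp p (u - z) + mu / 2 * dotp (u - z) (u - z) <= fine (h u).
Proof.
move=> hu h_sc qp; have hz := minimizer_dom hu.
have sub : subgradient h z (- p).
  move=> v; rewrite dotpNl.
  have [hv|] := ltP (h v) +oo%E; last by rewrite leye_eq => /eqP->; exact: leey.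
  rewrite (proper_fineK hv) (proper_fineK hz) -EFinD lee_fin.
  have [b qb] := qp v; rewrite -subr_ge0; set a := (X in 0 <= X).
  apply: (@quadratic_ge0_lin _ a b) => t t01; have := qb t t01.
  have {}t01 : 0 <= t <= 1 by have /andP[/ltW -> ->] := t01.
  have vz : z + t *: (v - z) = t *: v + (1 - t) *: z.
    by rewrite scalerBl scale1r scalerBr addrCA addrA addrAC.
  rewrite vz; have [hvz] := dom_convex hv hz t01.
  have := minimizer_fine_le hvz; rewrite /a; lra.
have := h_sc z u _ sub; rewrite (proper_fineK hu) (proper_fineK hz) -EFinD.
by rewrite lee_fin dotpNl enorm_sqr addrA.
Qed.

End minimizer.

Lemma sqr_line z0 z v (t : R) :
  let w := z + t *: (v - z) - z0 in
  dotp w w = dotp (z - z0) (z - z0) + 2 * t * dotp (z - z0) (v - z)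
             + t ^+ 2 * dotp (v - z) (v - z).
Proof.
rewrite /= addrAC; move: (z - z0) (v - z) => {}z {}v.
by rewrite dotpDl !dotpDr !dotpZr !dotpZl (dotpC v z); ring.
Qed.

(** Strong growth at z with slope g + 2 c (z - z0). The prox quadratic is expanded exactly around z,
    so its curvature c adds to mu / 2. *)
Lemma prox_three_points mu g c z0 z u : (h u < +oo)%E -> strongly_convex mu h ->
  is_minimizer (fun v => (dotp g v + c * enorm (v - z0) ^+ 2)%:E + h v)%E z ->
  dotp g z + c * dotp (z - z0) (z - z0) + fine (h z)
    + (c + mu / 2) * dotp (u - z) (u - z)
  <= dotp g u + c * dotp (u - z0) (u - z0) + fine (h u).
Proof.
move=> hu h_sc z_min.
have := minimizer_strong_growth (p := g + (2 * c) *: (z - z0)) z_min hu h_sc.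
have -> : dotp (u - z0) (u - z0) = dotp (z - z0) (z - z0)
    + 2 * dotp (z - z0) (u - z) + dotp (u - z) (u - z).
  have /= := sqr_line z0 z u 1.
  by rewrite scale1r subrKC mulr1 expr1n mul1r.
rewrite [dotp (g + _) (u - z)]dotpDl dotpZl (dotpBr u z g) => grow.
suff /grow : forall v, exists b, forall t, 0 < t <= 1 ->
    dotp g (z + t *: (v - z)) + c * enorm (z + t *: (v - z) - z0) ^+ 2
    <= dotp g z + c * enorm (z - z0) ^+ 2
       + t * dotp (g + (2 * c) *: (z - z0)) (v - z) + t ^+ 2 * b by lra.
move=> v; exists (c * dotp (v - z) (v - z)) => t _.
rewrite !enorm_sqr sqr_line; move: (z - z0) (v - z) => a b.
rewrite dotpDr dotpZr dotpDl dotpZl.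
by rewrite le_eqVlt; apply/orP; left; apply/eqP; ring.
Qed.

(** Add the three-point inequalities of z against z' and of z' against z: all but the squared
    distances cancels. *)
Lemma prox_unique mu g c z0 z z' u : 0 < mu -> 0 <= c -> (h u < +oo)%E ->
  strongly_convex mu h ->
  is_minimizer (fun v => (dotp g v + c * enorm (v - z0) ^+ 2)%:E + h v)%E z ->
  is_minimizer (fun v => (dotp g v + c * enorm (v - z0) ^+ 2)%:E + h v)%E z' ->
  z = z'.
Proof.
move=> mu0 c0 hu h_sc zm zm'.
have hz := minimizer_dom zm hu; have hz' := minimizer_dom zm' hu.
apply/eqP; rewrite -subr_eq0 -dotp_eq0 eq_le dotp_ge0 andbT.
have := prox_three_points hz h_sc zm'; have := prox_three_points hz' h_sc zm.
have := dotp_ge0 (z - z'); have := dotp_ge0 (z' - z).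
have c1 : 0 < c + mu / 2 by rewrite ltr_wpDl // divr_gt0.
rewrite -[_ <= 0](pmulr_rle0 _ c1).
move=> /(mulr_ge0 (ltW c1)) a1 /(mulr_ge0 (ltW c1)) a2; lra.
Qed.

End extended_convex.

(** Induction on the number of points: the new average combines the old one, with weight W / (W +
    v), and the new point. Membership in the domain is carried along because two-point convexity is
    assumed only there. *)
Lemma dom_jensen {R : realType} {N : nat} (dom : 'rV[R]_N -> Prop)
    (phi : 'rV[R]_N -> R) (w : nat -> R) (y : nat -> 'rV[R]_N) (m : nat) :
  (forall u v t, dom u -> dom v -> 0 <= t <= 1 ->
    dom (t *: u + (1 - t) *: v) /\
    phi (t *: u + (1 - t) *: v) <= t * phi u + (1 - t) * phi v) ->
  (0 < m)%N -> (forall j, 0 < w j) ->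
  (forall j, (j < m)%N -> dom (y j)) ->
  let W := \sum_(j < m) w j in
  let a := W^-1 *: \sum_(j < m) w j *: y j in
  dom a /\ W * phi a <= \sum_(j < m) w j * phi (y j).
Proof.
move=> cvx + w0; case: m => // m _ ydom /=.
elim: m ydom => [|m IH] ydom.
  rewrite !big_ord1 scalerA mulVf ?gt_eqF ?w0 // scale1r.
  by split => //; exact: ydom.
have [] := IH (fun j jm => ydom j (ltnW jm)).
rewrite 3!(big_ord_recr m.+1) /=.
set W := \sum_(j < m.+1) w j; set Y := \sum_(j < m.+1) w j *: y j => da pa.
have W0 : 0 < W.
  by rewrite /W big_ord_recr /= ltr_wpDl ?w0 // sumr_ge0 // => j _; exact: ltW.
have wm := w0 m.+1; set v := w m.+1 in wm *.
have Wv : 0 < W + v by exact: addr_gt0.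
have t01 : 0 <= W / (W + v) <= 1.
  by rewrite (divr_ge0 (ltW W0) (ltW Wv)) ler_pdivrMr // mul1r lerDl ltW.
have tc : 1 - W / (W + v) = v / (W + v).
  by rewrite -[X in X - _](@divff _ (W + v)) ?gt_eqF // -mulrBl addrC addKr.
have := cvx _ _ _ da (ydom m.+1 (ltnSn _)) t01; rewrite tc.
have -> : W / (W + v) *: (W^-1 *: Y) + v / (W + v) *: y m.+1
          = (W + v)^-1 *: (Y + v *: y m.+1).
  rewrite scalerA scalerDr scalerA; congr (_ *: _ + _ *: _); last exact: mulrC.
  by rewrite mulrAC divff ?mul1r // gt_eqF.
move=> [dn]; rewrite -(ler_pM2l Wv) => pn; split => //.
apply: (le_trans pn).
have -> : (W + v) * (W / (W + v) * phi (W^-1 *: Y) + v / (W + v) * phi (y m.+1))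
          = W * phi (W^-1 *: Y) + v * phi (y m.+1).
  by field; rewrite gt_eqF.
by rewrite lerD2r.
Qed.

(** * One accelerated proximal step *)

Section accelerated_step.
Context {R : realType} {N : nat}.
Variables (f : 'rV[R]_N -> R^o) (h : 'rV[R]_N -> \bar R) (L mu : R).
Variables (xs x0 : 'rV[R]_N).
Hypotheses (mu_gt0 : 0 < mu) (L_gt0 : 0 < L).
Hypothesis df : forall x, differentiable f x.
Hypothesis fL : forall x y, enorm (grad f x - grad f y) <= L * enorm (x - y).
Hypothesis f_convex : @convex_function R 'rV[R]_N setT f.
Hypotheses (h_pcc : proper_closed_convex h) (h_sc : strongly_convex mu h).
Hypothesis xs_min : is_minimizer (fun x => (f x)%:E + h x)%E xs.
Hypothesis x0_dom : (h x0 < +oo)%E.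

(** Since [fine] sends +oo to 0, this is the suboptimality of u only where h is finite; hence the
    domain conditions that accompany it. *)
Definition gap u : R := f u + fine (h u) - (f xs + fine (h xs)).

Let xs_dom : (h xs < +oo)%E.
Proof. exact: (minimizer_dom h_pcc xs_min x0_dom). Qed.

(** By first-order optimality [- grad f xs] is a subgradient of h at [xs]; strong convexity of h
    along it and convexity of f add up. *)
Lemma gap_growth u : (h u < +oo)%E ->
  mu / 2 * dotp (u - xs) (u - xs) <= gap u.
Proof.
move=> hu; have fg := convex_grad_ge df fL (ltW L_gt0) xs u f_convex.
suff : fine (h xs) - dotp (grad f xs) (u - xs) + mu / 2 * dotp (u - xs) (u - xs)
    <= fine (h u) by rewrite /gap; move: fg; lra.
apply: (minimizer_strong_growth h_pcc xs_min hu h_sc) => v.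
exists (L * dotp (v - xs) (v - xs)) => t _.
have := smooth_le df fL (ltW L_gt0) xs (xs + t *: (v - xs)).
rewrite (_ : _ + _ - _ = t *: (v - xs)); last by rewrite addrC addKr.
by rewrite !dotpZr dotpZl; lra.
Qed.

Lemma gap_ge0 u : (h u < +oo)%E -> 0 <= gap u.
Proof.
move=> hu; apply: le_trans (gap_growth hu).
by rewrite mulr_ge0 ?dotp_ge0 // divr_ge0 // ltW.
Qed.

Lemma gap_convex u v t : (h u < +oo)%E -> (h v < +oo)%E -> 0 <= t <= 1 ->
  (h (t *: u + (1 - t) *: v)%R < +oo)%E /\
  gap (t *: u + (1 - t) *: v) <= t * gap u + (1 - t) * gap v.
Proof.
move=> hu hv t01; have [-> huv] := dom_convex h_pcc hu hv t01; split => //.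
by have := convex_functionE u v f_convex t01; rewrite /gap; move: huv; lra.
Qed.

Variables (tau : R) (x xt y z g yn zn : 'rV[R]_N).
Hypotheses (tau_gt0 : 0 < tau) (tau_le : 2 * tau <= 1) (muL : mu <= 3 * tau * L).
Hypotheses (xt_dom : (h xt < +oo)%E) (y_dom : (h y < +oo)%E)
  (z_dom : (h z < +oo)%E).
Hypothesis xE : x = tau *: z + tau *: xt + (1 - tau - tau) *: y.
Hypothesis zn_min : is_minimizer (fun u =>
  (dotp g u + 3 * tau * L / 2 * enorm (u - z) ^+ 2)%:E + h u)%E zn.
Hypothesis yn_min : is_minimizer (fun u =>
  (dotp g u + 3 * L / 2 * enorm (u - x) ^+ 2)%:E + h u)%E yn.

Let Z u := dotp (u - xs) (u - xs).

Let three_dom u v w : (h u < +oo)%E -> (h v < +oo)%E -> (h w < +oo)%E ->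
  (h (tau *: u + tau *: v + (1 - tau - tau) *: w)%R < +oo)%E /\
  fine (h (tau *: u + tau *: v + (1 - tau - tau) *: w))
  <= tau * fine (h u) + tau * fine (h v) + (1 - tau - tau) * fine (h w).
Proof.
move=> hu hv hw.
have [tau0 tau1] := (tau_gt0, tau_le).
(* The three-point combination is nested: weights c and 1 - c on v and w, then tau and 1 - tau, with
   (1 - tau) c = tau. *)
pose c := tau / (1 - tau); have t1 : 0 < 1 - tau by lra.
have c01 : 0 <= c <= 1.
  by rewrite divr_ge0 ?(ltW tau_gt0) ?(ltW t1) //= ler_pdivrMr // mul1r; lra.
have ct : (1 - tau) * c = tau by rewrite mulrC divfK // gt_eqF.
have [hvw vw] := dom_convex h_pcc hv hw c01.
have t01 : 0 <= tau <= 1 by apply/andP; split; lra.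
have [] := dom_convex h_pcc hu hvw t01.
have -> : tau *: u + (1 - tau) *: (c *: v + (1 - c) *: w)
    = tau *: u + tau *: v + (1 - tau - tau) *: w.
  by rewrite scalerDr !scalerA ct mulrBr mulr1 ct addrA.
move=> -> le; split => //; apply: (le_trans le).
have := ler_wpM2l (ltW t1) vw.
have cv := congr1 ( *%R^~ (fine (h v))) ct.
have cw := congr1 ( *%R^~ (fine (h w))) ct.
by move: cv cw => /= cv cw; lra.
Qed.

Lemma accelerated_step :
  gap yn <= tau * gap xt + (1 - 2 * tau) * gap y
    + (3 / 2 * tau ^+ 2 * L + tau * mu / 6) * Z z
    - (3 / 2 * tau ^+ 2 * L + tau * mu / 2) * Z zn
    + 3 * (tau / mu) * dotp (g - grad f x) (g - grad f x).
Proof.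
have [tau0 tau1] := (tau_gt0, tau_le).
have zn_dom := minimizer_dom h_pcc zn_min x0_dom.
have yn_dom := minimizer_dom h_pcc yn_min x0_dom.
(* The competitor in the y-subproblem is x with z replaced by [zn], so it lies at tau (zn - z) from
   x. *)
pose yb := tau *: zn + tau *: xt + (1 - tau - tau) *: y.
have [yb_dom h_yb] := three_dom zn_dom xt_dom y_dom.
have F1 := smooth_le df fL (ltW L_gt0) x yn.
have F2 := minimizer_fine_le h_pcc yn_min yb_dom; rewrite -/yb in h_yb F2.
have ybx : yb - x = tau *: (zn - z).
  by rewrite /yb xE !opprD addrACA subrr addr0 addrACA subrr addr0 -scalerBr.
(* Multiplied by tau, its term in |zn - z|^2 has the coefficient 3/2 tau^2 L and cancels the one
   produced by [yb] in [F2]. *)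
have F4 := prox_three_points h_pcc xs_dom h_sc zn_min.
have F5 u := convex_grad_ge df fL (ltW L_gt0) x u f_convex.
(* Once [F2] and tau times [F4] are added, [zn] drops out of the error terms; what remains is - <e,
   yn - x> + tau <e, xs - z>. Young with L fills the quadratic budget 3 L / 2; Young with mu / 3
   costs tau mu / 6 of |z - xs|^2. Each contributes 3/2 (tau / mu) |e|^2, the first because mu <= 3
   tau L. *)
have F6 := young_dotp (- (g - grad f x)) (yn - x) L_gt0.
have F7 := young_dotp (g - grad f x) (xs - z) (divr_gt0 mu_gt0 (ltr0n _ 3)).
have gE : g = grad f x + (g - grad f x) by rewrite addrC subrK.
set e := g - grad f x in gE F6 F7 *; set G := grad f x in gE F1 F5 *.
clearbody e G.
have dsym u : dotp (xs - u) (xs - u) = Z u.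
  by rewrite -opprB dotpNl dotpNr opprK.
rewrite !enorm_sqr ybx !dotpZr !dotpZl in F2.
rewrite (dsym zn) (dsym z) in F4; rewrite (dsym z) in F7.
have {}F5a := F5 xs; have {}F5b := F5 xt; have F5c := F5 y.
have xlin (w : 'rV[R]_N) : dotp w x
    = tau * dotp w z + tau * dotp w xt + (1 - tau - tau) * dotp w y.
  by rewrite xE !dotpDr !dotpZr.
have yblin (w : 'rV[R]_N) : dotp w yb
    = tau * dotp w zn + tau * dotp w xt + (1 - tau - tau) * dotp w y.
  by rewrite /yb !dotpDr !dotpZr.
rewrite (yblin g) in F2.
rewrite !(dotpBr _ _ G) xlin in F1 F5a F5b F5c.
rewrite !(dotpBr _ _ e) in F7.
rewrite (dotpNl e) !(dotpBr _ _ e) dotpNl dotpNr opprK xlin in F6.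
rewrite gE !(dotpDl G e) in F2 F4.
have e0 := dotp_ge0 e.
have {}F6 : - (dotp e yn - (tau * dotp e z + tau * dotp e xt
    + (1 - tau - tau) * dotp e y))
    <= 3 / 2 * (tau / mu) * dotp e e + L / 2 * dotp (yn - x) (yn - x).
  apply: (le_trans F6); rewrite lerD2r ler_wpM2r // -div1r ler_pdivrMr ?mulr_gt0 //.
  have -> : 3 / 2 * (tau / mu) * (2 * L) = 3 * tau * L / mu.
    by field; rewrite gt_eqF.
  by rewrite ler_pdivlMr // mul1r.
have {}F7 : tau * (dotp e xs - dotp e z)
    <= 3 / 2 * (tau / mu) * dotp e e + tau * mu / 6 * Z z.
  apply: (le_trans (ler_wpM2l (ltW tau_gt0) F7)).
  by rewrite le_eqVlt; apply/orP; left; apply/eqP; field; rewrite gt_eqF.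
have {}F4 := ler_wpM2l (ltW tau_gt0) F4.
have {}F5a := ler_wpM2l (ltW tau_gt0) F5a.
have {}F5b := ler_wpM2l (ltW tau_gt0) F5b.
have t2 : 0 <= 1 - 2 * tau by lra.
have {}F5c := ler_wpM2l t2 F5c.
rewrite /gap; lra.
Qed.

(** The weights tau and 1 - 2 tau of z - xt and y - xt sum to at most 1, so convexity of the square
    applies. Both differences pass through [xs]; the distances of y and xt are turned into gaps,
    while that of z is kept since the recursion tracks it. *)
Lemma sqr_dist_snapshot :
  dotp (x - xt) (x - xt) <= 2 * tau * Z z
    + 4 / mu * (1 - 2 * tau) * gap y + 4 / mu * gap xt.
Proof.
have [tau0 tau1] := (tau_gt0, tau_le).
set s := 1 - 2 * tau; have s0 : 0 <= s by rewrite /s; lra.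
have -> : x - xt = tau *: (z - xt) + s *: (y - xt).
  by apply/rowP => i; rewrite xE !mxE /s; ring.
have near u : dotp (u - xt) (u - xt) <= 2 * Z u + 2 * Z xt.
  rewrite (_ : u - xt = (u - xs) - (xt - xs)); first exact: sqr_enormB_le.
  by rewrite opprB addrA subrK.
have far u : (h u < +oo)%E -> 2 * Z u <= 4 / mu * gap u.
  move=> /gap_growth hu; rewrite mulrAC ler_pdivlMr //.
  by move: hu; rewrite /Z; lra.
have zt := near z; have yt := near y; have yg := far _ y_dom.
have xg := far _ xt_dom; have Z0 := dotp_ge0 (xt - xs).
have pr := dotp_ge0 ((z - xt) - (y - xt)).
move: (z - xt) (y - xt) zt yt pr => p r zt yt pr.
rewrite dotpBl !dotpBr (dotpC r p) in pr.
rewrite dotpDl !dotpDr !dotpZl !dotpZr (dotpC r p).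
have ts0 : 0 <= tau * s by rewrite mulr_ge0 // ltW.
have {}pr := mulr_ge0 ts0 pr.
have P0 := dotp_ge0 p; have R0 := dotp_ge0 r.
have a1 := mulr_ge0 (mulr_ge0 (ltW tau_gt0) (ltW tau_gt0)) P0.
have a2 := mulr_ge0 ts0 R0.
have {}zt := ler_wpM2l (ltW tau_gt0) zt; have {}yt := ler_wpM2l s0 yt.
have {}yg := ler_wpM2l s0 yg; have a3 := mulr_ge0 (ltW tau_gt0) Z0.
have -> : 4 / mu * s * gap y = s * (4 / mu * gap y) by ring.
apply: (@le_trans _ _ (tau * dotp p p + s * dotp r r)).
  by move: pr a1 a2; rewrite /s; lra.
by move: zt yt yg xg a3; rewrite -/(Z xt) /s; lra.
Qed.

End accelerated_step.

(** * Linear convergence over the epochs *)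

Section linear_rate.
Context {R : realType}.

Lemma bernoulli (x : R) n : 0 <= x -> 1 + n%:R * x <= (1 + x) ^+ n.
Proof.
move=> x0; elim: n => [|n IH]; first by rewrite mul0r addr0 expr0.
rewrite exprS -natr1; have n0 := ler0n R n.
have := mulr_ge0 (mulr_ge0 n0 x0) x0; have := mulr_ge0 x0 (mulr_ge0 n0 x0).
have := ler_wpM2l (addr_ge0 ler01 x0) IH; lra.
Qed.

(** The upper counterpart of Bernoulli: with n x = 1/12 it gives theta^m <= 12/11. *)
Lemma expr1D_le (x : R) n : 0 <= x -> n%:R * x <= 1 ->
  (1 + x) ^+ n * (1 - n%:R * x) <= 1.
Proof.
move=> x0; elim: n => [|n IH]; first by rewrite mul0r subr0 expr0 mulr1.
rewrite exprS -natr1 => nx; have n0 := ler0n R n.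
have /IH h : n%:R * x <= 1 by lra.
have e0 : 0 <= (1 + x) ^+ n by rewrite exprn_ge0 // addr_ge0.
apply: le_trans h; rewrite mulrAC [leRHS]mulrC ler_wpM2r //.
have := mulr_ge0 (mulr_ge0 n0 x0) x0; have := mulr_ge0 x0 x0; lra.
Qed.

Variables (S m : nat) (D Z Dt : nat -> R) (p r : R).
Let tau : R := (2 * m%:R)^-1.
Let theta : R := 1 + (12 * m%:R)^-1.
(** The gradient variance adds tau / 15 to the coefficient tau of the snapshot gap, and (1 - 2 tau)
    tau / 15 to the coefficient 1 - 2 tau of the current gap, whence c and q. *)
Let c := 16 / 15 * tau.
Let q := (1 - 2 * tau) * (1 + tau / 15).
Let Theta := \sum_(j < m) theta ^+ j.
Hypothesis m_gt0 : (0 < m)%N.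
Hypotheses (p_ge0 : 0 <= p) (pr : theta * p <= r).
Hypothesis D_ge0 : forall k, (k <= S * m)%N -> 0 <= D k.
Hypothesis Z_ge0 : forall k, 0 <= Z k.
Hypothesis Dt_ge0 : forall s, (s <= S)%N -> 0 <= Dt s.
Hypothesis step : forall s j, (s < S)%N -> (j < m)%N ->
  D (s * m + j).+1 <= c * Dt s + q * D (s * m + j)%N + p * Z (s * m + j)%N
                      - r * Z (s * m + j).+1.
Hypothesis snapshot : forall s, (s < S)%N ->
  Theta * Dt s.+1 <= \sum_(j < m) theta ^+ j * D (s * m + j).+1.

Let mR : 1 <= m%:R :> R. Proof. by rewrite ler1n. Qed.
Let mR0 : m%:R != 0 :> R. Proof. by rewrite pnatr_eq0 -lt0n. Qed.

Let tau_bounds : 0 < tau /\ 2 * tau <= 1.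
Proof.
rewrite /tau invr_gt0 mulr_gt0 ?ltr0n //; split => //.
by rewrite invfM mulrA divff ?mul1r ?invf_le1 ?ltr0n // pnatr_eq0.
Qed.

Let thetaE : theta = 1 + tau / 6.
Proof. by rewrite /theta /tau; field. Qed.

Let theta_ge1 : 1 <= theta.
Proof. by have [? _] := tau_bounds; rewrite thetaE; lra. Qed.

Let theta_m_ge : 13 / 12 <= theta ^+ m.
Proof.
have [t0 _] := tau_bounds; rewrite thetaE.
have -> : 13 / 12 = 1 + m%:R * (tau / 6) :> R by rewrite /tau; field.
by apply: bernoulli; lra.
Qed.

Let theta_m_le : theta ^+ m <= 12 / 11.
Proof.
have [t0 _] := tau_bounds.
have mx : m%:R * (tau / 6) = 12^-1 by rewrite /tau; field.
have := @expr1D_le (tau / 6) m; rewrite -thetaE mx.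
have tau6 : 0 <= tau / 6 by lra.
have le1 : 12^-1 <= 1 :> R by lra.
by move=> /(_ tau6 le1); lra.
Qed.

Let q_ge0 : 0 <= q.
Proof. by have [t0 t1] := tau_bounds; rewrite /q; apply: mulr_ge0; lra. Qed.

(** The balance that closes an epoch: the share 1 - q theta of the gaps set aside at each step must
    pay for the snapshot term of the next potential, enlarged by theta^m. *)
Let weights : c * theta ^+ m <= 1 - q * theta.
Proof.
have [t0 t1] := tau_bounds.
have c0 : 0 <= c by rewrite /c; lra.
apply: (le_trans (ler_wpM2l c0 theta_m_le)); rewrite /c /q thetaE.
have t2 := mulr_ge0 (ltW t0) (ltW t0).
have := mulr_ge0 (ltW t0) t2; lra.
Qed.

(** Step j is weighted by theta^j. Of each new gap the share q theta is passed to the next step and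
    the share 1 - q theta is set aside for the snapshot; the distances telescope since theta p <=
    r. *)
Let inner s i : (s < S)%N -> (i <= m)%N ->
  \sum_(j < i) (1 - q * theta) * (theta ^+ j * D (s * m + j).+1)
    + theta ^+ i * (q * D (s * m + i)%N + p * Z (s * m + i)%N)
  <= q * D (s * m)%N + p * Z (s * m)%N + c * (\sum_(j < i) theta ^+ j) * Dt s.
Proof.
move=> sS; elim: i => [|i IH] im.
  by rewrite !big_ord0 mulr0 mul0r add0r addr0 expr0 mul1r addn0.
have e0 : 0 <= theta ^+ i by rewrite exprn_ge0 // (le_trans ler01).
have := ler_wpM2l e0 (step sS im); have {IH} := IH (ltnW im).
have := ler_wpM2l e0 (ler_wpM2r (Z_ge0 (s * m + i).+1) pr).
rewrite !big_ord_recr /= addnS exprS.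
move: (\sum_(j < i) (1 - q * theta) * _) (\sum_(j < i) theta ^+ j) (theta ^+ i).
move: (D _.+1) (Z _.+1) (D (s * m + i)%N) (Z (s * m + i)%N).
move: (D (s * m)%N) (Z (s * m)%N) (Dt s) c q theta => *; lra.
Qed.

(** The potential at the start of epoch s: the right-hand side of [inner] for a full epoch. *)
Let Phi s := q * D (s * m)%N + p * Z (s * m)%N + c * Theta * Dt s.

Let Phi_ge0 s : (s <= S)%N -> c * Theta * Dt s <= Phi s.
Proof.
move=> sS; have Ds : 0 <= D (s * m)%N by apply: D_ge0; rewrite leq_mul2r sS orbT.
by rewrite /Phi lerDr; apply: addr_ge0; apply: mulr_ge0.
Qed.

Let Theta_ge : m%:R <= Theta.
Proof.
rewrite -[m in m%:R]card_ord -sum1_card natr_sum; apply: ler_sum => j _.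
exact: exprn_ege1.
Qed.

(** Theta has m terms, each at least 1, and m tau = 1/2. The bound lets the snapshot gap be
    recovered from the potential. *)
Let cTheta : 8 / 15 <= c * Theta.
Proof.
have [t0 _] := tau_bounds.
have := ler_wpM2l (ltW t0) Theta_ge; rewrite {1}/tau invfM mulrVK ?unitfE //.
by rewrite /c; lra.
Qed.

Let contraction s : (s < S)%N -> Phi s.+1 <= 12 / 13 * Phi s.
Proof.
move=> sS; have [t0 t1] := tau_bounds.
suff : theta ^+ m * Phi s.+1 <= Phi s.
  have : 0 <= Phi s.+1.
    apply: le_trans (Phi_ge0 sS); rewrite mulr_ge0 ?Dt_ge0 //.
    by apply: le_trans cTheta; lra.
  by move=> /(ler_wpM2r); move=> /(_ _ _ theta_m_ge); lra.
have := inner sS (leqnn m); rewrite -mulr_sumr -/Theta.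
apply: le_trans; rewrite {1}/Phi mulSn addnC mulrDr addrC lerD2r.
have w0 : 0 <= 1 - q * theta.
  have c0 : 0 <= c by rewrite /c; lra.
  apply: le_trans (mulr_ge0 c0 _) weights.
  by rewrite exprn_ge0 // (le_trans ler01).
(* Jensen turns the gaps set aside into Theta Dt (s+1), and [weights] turns their factor into c
   theta^m. *)
apply: le_trans (ler_wpM2l w0 (snapshot sS)).
have T0 : 0 <= Theta * Dt s.+1.
  by rewrite mulr_ge0 ?Dt_ge0 // (le_trans _ Theta_ge).
apply: le_trans (ler_wpM2r T0 weights); rewrite le_eqVlt.
by apply/orP; left; apply/eqP; ring.
Qed.

Lemma linear_rate : Dt 0 = D 0 -> p * Z 0 <= 16 / 5 * D 0 ->
  Dt S <= 11 * (12 / 13) ^+ S * D 0.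
Proof.
move=> D0t Z0; have [t0 t1] := tau_bounds.
have PhiS s : (s <= S)%N -> Phi s <= (12 / 13) ^+ s * Phi 0.
  elim: s => [|s IH] sS; first by rewrite expr0 mul1r.
  apply: (le_trans (contraction sS)); rewrite exprS -[leRHS]mulrA.
  by apply: ler_wpM2l; [lra | exact: IH (ltnW sS)].
have D0 := D_ge0 (leq0n _).
have q1 : q <= 1.
  by have := mulr_ge0 (ltW t0) (ltW t0); rewrite /q; lra.
have rho0 : 0 <= (12 / 13) ^+ S :> R by rewrite exprn_ge0.
have k0 : 0 < c * Theta by apply: lt_le_trans cTheta; lra.
(* The gap and distance terms cost at most (1 + 16/5) D 0, which is below 10 c Theta D 0 because c
   Theta >= 8/15; the snapshot term adds one more c Theta D 0. *)
have le0 : Phi 0 <= 11 * (c * Theta) * D 0.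
  rewrite /Phi mul0n D0t.
  have := ler_wpM2r D0 q1; have := ler_wpM2r D0 cTheta; lra.
have := le_trans (Phi_ge0 (leqnn S)) (PhiS S (leqnn S)).
move=> /le_trans /(_ (ler_wpM2l rho0 le0)) PhiSS.
rewrite -(ler_pM2l k0); apply: (le_trans PhiSS).
by rewrite le_eqVlt; apply/orP; left; apply/eqP; ring.
Qed.

End linear_rate.

(** * Trajectories as functions of the draws *)

Section trajectories.
Context {R : realType} {N1 N2 n2 : nat}.
Variables (F : 'rV[R]_N1 -> R^o) (G_ : 'I_n2 -> 'rV[R]_N2 -> 'rV[R]_N1).
Variables (h : 'rV[R]_N2 -> \bar R) (L mu : R) (x0 : 'rV[R]_N2).
Variables (S m A B : nat) (theta alpha tau1 tau2 : R).
Hypotheses (h_pcc : proper_closed_convex h) (h_sc : strongly_convex mu h).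
Hypotheses (mu_gt0 : 0 < mu) (L_ge0 : 0 <= L) (alpha_ge0 : 0 <= alpha).
Hypotheses (theta_gt0 : 0 < theta) (m_gt0 : (0 < m)%N).
Hypothesis x0_dom : (h x0 < +oo)%E.

Local Notation sock_run :=
  (@sock R N1 N2 n2 F G_ h L x0 S m A B theta alpha tau1 tau2).

Lemma epoch_split k : (k < S * m)%N ->
  exists s j, [/\ (s < S)%N, (j < m)%N & k = (s * m + j)%N].
Proof.
move=> kSm; exists (k %/ m)%N, (k %% m)%N; split; last exact: divn_eq.
  by rewrite ltn_divLR.
by rewrite ltn_mod.
Qed.

Section adapted.
Variables (a a' : nat -> 'I_A -> 'I_n2) (b b' : nat -> 'I_B -> 'I_n2).
Variables (r r' : iterates R N2).
Hypotheses (run : sock_run a b r) (run' : sock_run a' b' r').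

Let snap_eq K : (forall k, (k <= K)%N -> it_y r k = it_y r' k) ->
  forall s, (s <= S)%N -> (s * m <= K)%N -> it_snap r s = it_snap r' s.
Proof.
move=> yE [|s] sS smK; first by rewrite (sock_snap0 run) (sock_snap0 run').
rewrite (sock_snap run sS) (sock_snap run' sS); congr (_ *: _).
apply: eq_bigr => j _; congr (_ *: _); apply: yE.
by apply: leq_trans smK; rewrite mulSn addnC ltn_add2r.
Qed.

(* The prox subproblems have unique minimizers, so the first K steps of a
   trajectory are a function of the first K draws. *)
Lemma sock_yz_adapted K : (K <= S * m)%N ->
  (forall k, (k < K)%N -> a k = a' k /\ b k = b' k) ->
  forall k, (k <= K)%N -> it_y r k = it_y r' k /\ it_z r k = it_z r' k.
Proof.
elim: K => [|K IH] KS ab k.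
  rewrite leqn0 => /eqP->; rewrite (sock_y0 run) (sock_y0 run').
  by rewrite (sock_z0 run) (sock_z0 run').
have {}IH := IH (ltnW KS) (fun k kK => ab k (ltnW kK)).
rewrite leq_eqVlt ltnS => /orP[/eqP->|]; last exact: IH.
have [aE bE] := ab K (ltnSn K); have [yE zE] := IH K (leqnn K).
have [s [j [sS jm KE]]] := epoch_split KS.
have snapE : it_snap r s = it_snap r' s.
  apply: (@snap_eq K) => [i /IH[]//||]; first exact: ltnW.
  by rewrite KE leq_addr.
have xE : it_x r K.+1 = it_x r' K.+1.
  rewrite KE (sock_x run sS jm) (sock_x run' sS jm).
  by rewrite -KE yE zE snapE.
have rz := sock_z run sS jm; have rz' := sock_z run' sS jm.
have ry := sock_y run sS jm; have ry' := sock_y run' sS jm.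
rewrite /= -KE -?aE -?bE -?xE -?snapE -?zE in rz rz' ry ry'.
have c1 : 0 <= 3 * L / 2 by rewrite divr_ge0 // mulr_ge0.
have c2 : 0 <= (2 * alpha)^-1 by rewrite invr_ge0 mulr_ge0.
split.
  exact: (prox_unique h_pcc mu_gt0 c1 x0_dom h_sc ry ry').
exact: (prox_unique h_pcc mu_gt0 c2 x0_dom h_sc rz rz').
Qed.

Lemma sock_snap_adapted K s : (K <= S * m)%N ->
  (forall k, (k < K)%N -> a k = a' k /\ b k = b' k) ->
  (s <= S)%N -> (s * m <= K)%N -> it_snap r s = it_snap r' s.
Proof.
move=> KS ab; apply: snap_eq => k kK.
by have [] := sock_yz_adapted KS ab kK.
Qed.

(** The extrapolation point of an iteration is formed before its draws, so only strictly earlier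
    draws matter; the variance bound needs exactly this. *)
Lemma sock_x_adapted s j : (s < S)%N -> (j < m)%N ->
  (forall k, (k < s * m + j)%N -> a k = a' k /\ b k = b' k) ->
  it_x r (s * m + j).+1 = it_x r' (s * m + j).+1.
Proof.
move=> sS jm ab; have KS : (s * m + j <= S * m)%N.
  apply: (@leq_trans (s.+1 * m)); last by rewrite leq_mul2r sS orbT.
  by rewrite mulSn addnC leq_add2r ltnW.
rewrite (sock_x run sS jm) (sock_x run' sS jm).
have [-> ->] := sock_yz_adapted KS ab (leqnn _).
by rewrite (sock_snap_adapted KS ab) ?leq_addr // ltnW.
Qed.

End adapted.

Section domain.
Variables (a : nat -> 'I_A -> 'I_n2) (b : nat -> 'I_B -> 'I_n2).
Variable r : iterates R N2.
Hypothesis run : sock_run a b r.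

Lemma sock_dom k : (k <= S * m)%N ->
  (h (it_y r k) < +oo)%E /\ (h (it_z r k) < +oo)%E.
Proof.
case: k => [_|k kS]; first by rewrite (sock_y0 run) (sock_z0 run).
have [s [j [sS jm ->]]] := epoch_split kS; split.
  exact: (minimizer_dom h_pcc (sock_y run sS jm) x0_dom).
exact: (minimizer_dom h_pcc (sock_z run sS jm) x0_dom).
Qed.

Lemma sock_snap_jensen (phi : 'rV[R]_N2 -> R) s :
  (forall u v t, (h u < +oo)%E -> (h v < +oo)%E -> 0 <= t <= 1 ->
    (h (t *: u + (1 - t) *: v)%R < +oo)%E /\
    phi (t *: u + (1 - t) *: v) <= t * phi u + (1 - t) * phi v) ->
  (s < S)%N ->
  (h (it_snap r s.+1) < +oo)%E /\
  (\sum_(j < m) theta ^+ j) * phi (it_snap r s.+1)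
  <= \sum_(j < m) theta ^+ j * phi (it_y r (s * m + j).+1).
Proof.
move=> cvx sS; rewrite (sock_snap run sS).
apply: (@dom_jensen _ _ (fun u => h u < +oo)%E phi (fun j => theta ^+ j)
  (fun j => it_y r (s * m + j).+1)) => // [j|j jm]; first exact: exprn_gt0.
apply: (sock_dom _).1; apply: (@leq_trans (s.+1 * m)).
  by rewrite mulSn addnC ltn_add2r.
by rewrite leq_mul2r sS orbT.
Qed.

Lemma sock_snap_dom s : (s <= S)%N -> (h (it_snap r s) < +oo)%E.
Proof.
case: s => [_|s sS]; first by rewrite (sock_snap0 run).
by have [] := sock_snap_jensen (dom_convex h_pcc) sS.
Qed.

End domain.
End trajectories.

(** * The expected recursion *)

Section parameters.
Context {R : realType}.

Lemma batch_size (n : nat) (x : R) : n%:Z = Num.max 1 (Num.ceil x) ->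
  (0 < n)%N /\ x <= n%:R.
Proof.
move=> nE; have n1 : (1 <= n%:Z)%R by rewrite nE le_max lexx.
split; first by [].
rewrite -[n%:R]/((n%:Z)%:~R) nE -ceil_le_int.
by rewrite le_max lexx orbT.
Qed.

(** With s = sqrt (L / mu) >= 1, rounding up gives s/2 <= m < s/2 + 1. The lower bound says tau s <=
    1; the upper one gives m <= 3/2 s^2, that is mu <= 3 tau L. *)
Lemma epoch_length (m : nat) (L mu : R) : 0 < mu -> mu <= L ->
  m%:Z = Num.ceil (2^-1 * Num.sqrt (L / mu)) ->
  let tau := (2 * m%:R)^-1 in
  [/\ (0 < m)%N, tau ^+ 2 * L <= mu & mu <= 3 * tau * L].
Proof.
move=> mu0 muL mE; set s := Num.sqrt (L / mu).
have Lmu : 1 <= L / mu by rewrite ler_pdivlMr // mul1r.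
have s1 : 1 <= s by rewrite -[1]sqrtr1 ler_sqrt // (le_trans ler01).
have LE : L = s ^+ 2 * mu.
  by rewrite sqr_sqrtr ?divfK ?gt_eqF // (le_trans ler01).
have [ms1 ms2] : m%:R - 1 < 2^-1 * s /\ 2^-1 * s <= m%:R :> R.
  have /andP[] := ceil_itv (2^-1 * s); rewrite -mE.
  by rewrite intrB.
have m0 : 0 < m%:R :> R by apply: lt_le_trans ms2; lra.
have m0N : (0 < m)%N by rewrite -(ltr0n R).
move=> tau; have mtau : m%:R = (2 * tau)^-1.
  by rewrite /tau; field; rewrite gt_eqF.
split => //.
  rewrite LE mulrA -exprMn ler_piMl ?(ltW mu0) // exprn_ile1 //.
    by rewrite mulr_ge0 ?invr_ge0 ?mulr_ge0 //; lra.
  rewrite /tau mulrC ler_pdivrMr ?mul1r ?mulr_gt0 //; lra.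
rewrite LE mulrA ler_peMl ?(ltW mu0) //.
have -> : 3 * tau * s ^+ 2 = (3 / 2 * s ^+ 2) / m%:R.
  by rewrite /tau; field; rewrite gt_eqF.
by rewrite ler_pdivlMr // mul1r; have := ler_wpM2l (le_trans ler01 s1) s1; lra.
Qed.

End parameters.

Section expectation.
Context {R : realType} {N1 N2 n1 n2 : nat}.
Variables (F_ : 'I_n1 -> 'rV[R]_N1 -> R^o).
Variables (G_ : 'I_n2 -> 'rV[R]_N2 -> 'rV[R]_N1).
Variables (h : 'rV[R]_N2 -> \bar R) (LF BF LG BG L mu : R).
Variables (xs x0 : 'rV[R]_N2) (S m A B : nat).
Hypotheses (n1_gt0 : (0 < n1)%N) (n2_gt0 : (0 < n2)%N).
Hypotheses (h_pcc : proper_closed_convex h) (h_sc : strongly_convex mu h).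
Hypotheses (mu_gt0 : 0 < mu) (L_ge_mu : mu <= L).
Hypothesis F_smooth : forall i, smooth_fun LF (F_ i).
Hypothesis F_bounded : forall i x, enorm (grad (F_ i) x) <= BF.
Hypothesis G_smooth : forall j, smooth_map LG (G_ j).
Hypothesis G_bounded : forall j x, specnorm (jac (G_ j) x) <= BG.
Hypothesis L_smooth : forall i j x y,
  enorm (trmul (jac (G_ j) x) (grad (F_ i) (avg G_ x))
         - trmul (jac (G_ j) y) (grad (F_ i) (avg G_ y))) <= L * enorm (x - y).

Let f : 'rV[R]_N2 -> R^o := avg F_ \o avg G_.

Hypothesis f_convex : @convex_function R 'rV[R]_N2 setT f.
Hypothesis xs_min : is_minimizer (fun x => (f x)%:E + h x)%E xs.
Hypothesis x0_dom : (h x0 < +oo)%E.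
Hypothesis mE : m%:Z = Num.ceil (2^-1 * Num.sqrt (L / mu)).
Hypothesis AE :
  A%:Z = Num.max 1 (Num.ceil (720 * BG ^+ 4 * LF ^+ 2 / mu ^+ 2)).
Hypothesis BE :
  B%:Z = Num.max 1 (Num.ceil (720 * BF ^+ 2 * LG ^+ 2 / mu ^+ 2)).

Let tau : R := (2 * m%:R)^-1.
Let theta : R := 1 + (12 * m%:R)^-1.
Let alpha : R := (3 * tau * L)^-1.

Let I := ('I_(S * m) * ('I_A + 'I_B))%type.
Let Omega := {ffun I -> 'I_n2}.
Variables (a : Omega -> nat -> 'I_A -> 'I_n2) (b : Omega -> nat -> 'I_B -> 'I_n2).
Variable r : Omega -> iterates R N2.
Hypothesis aE : forall w (k : 'I_(S * m)) i, a w k i = w (k, inl i).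
Hypothesis bE : forall w (k : 'I_(S * m)) i, b w k i = w (k, inr i).
Hypothesis r_sock : forall w,
  sock (avg F_) G_ h L x0 S m theta alpha tau tau (a w) (b w) (r w).

Let L_gt0 : 0 < L. Proof. exact: lt_le_trans L_ge_mu. Qed.
Let m_gt0 : (0 < m)%N. Proof. by have [] := epoch_length mu_gt0 L_ge_mu mE. Qed.
Let A_gt0 : (0 < A)%N. Proof. by have [] := batch_size AE. Qed.
Let B_gt0 : (0 < B)%N. Proof. by have [] := batch_size BE. Qed.
Let m1 : 1 <= m%:R :> R. Proof. by rewrite ler1n. Qed.
Let tau_gt0 : 0 < tau.
Proof. by rewrite invr_gt0 mulr_gt0 // ltr0n. Qed.
Let tau_le : 2 * tau <= 1.
Proof.
by rewrite /tau invfM mulrA divff ?mul1r ?invf_le1 ?ltr0n ?pnatr_eq0.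
Qed.
Let alpha_ge0 : 0 <= alpha.
Proof. by rewrite invr_ge0 !mulr_ge0 // ltW. Qed.
Let theta_gt0 : 0 < theta.
Proof. by rewrite addr_gt0 // invr_gt0 mulr_gt0 // ltr0n. Qed.

Let df x : differentiable f x.
Proof. exact: (differentiable_compositional F_smooth G_smooth). Qed.
Let fL x y : enorm (grad f x - grad f y) <= L * enorm (x - y).
Proof.
exact: (grad_compositional_lipschitz n1_gt0 n2_gt0 F_smooth G_smooth).
Qed.

Local Notation gap := (gap f h xs).
Local Notation dist2 u := (dotp (u - xs) (u - xs)).
(** Sums over all equiprobable outcomes stand for expectations; the common normalizing factor is
    restored only at the end. *)
Let D k := \sum_(w : Omega) gap (it_y (r w) k).
Let Z k := \sum_(w : Omega) dist2 (it_z (r w) k).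
Let Dt s := \sum_(w : Omega) gap (it_snap (r w) s).

(** The constant 720 makes each quotient at most mu^2 / 720, and 4 / 720 = 1 / 180. *)
Let variance_bound :
  2 * (BF ^+ 2 * LG ^+ 2 / B%:R) + 2 * (BG ^+ 4 * LF ^+ 2 / A%:R)
  <= mu ^+ 2 / 180.
Proof.
have [_ Ax] := batch_size AE; have [_ Bx] := batch_size BE.
have mu2 : 0 < mu ^+ 2 by rewrite exprn_gt0.
have bound x (n : nat) : (0 < n)%N -> 720 * x / mu ^+ 2 <= n%:R ->
    x / n%:R <= mu ^+ 2 / 720.
  move=> n0; rewrite ler_pdivrMr // ler_pdivrMr ?ltr0n //; lra.
have := bound (BG ^+ 4 * LF ^+ 2) A A_gt0; rewrite [720 * _]mulrA => /(_ Ax).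
have := bound (BF ^+ 2 * LG ^+ 2) B B_gt0; rewrite [720 * _]mulrA => /(_ Bx).
lra.
Qed.

Let upd_draws (w : Omega) (k0 : 'I_(S * m)) u v k : (k < k0)%N ->
  a (upd w (k0, u) v) k = a w k /\ b (upd w (k0, u) v) k = b w k.
Proof.
move=> kk0; have kS := ltn_trans kk0 (ltn_ord k0).
have ne c : ((Ordinal kS, c) : I) != (k0, u).
  by apply/eqP => -[/(congr1 val) /= kE _]; rewrite kE ltnn in kk0.
split; apply/funext => i.
  by have := aE w (Ordinal kS) i; rewrite /= => ->;
     rewrite (aE _ (Ordinal kS)) upd_neq.
by have := bE w (Ordinal kS) i; rewrite /= => ->;
   rewrite (bE _ (Ordinal kS)) upd_neq.
Qed.

Lemma expected_step s j : (s < S)%N -> (j < m)%N ->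
  D (s * m + j).+1 <= 16 / 15 * tau * Dt s
    + (1 - 2 * tau) * (1 + tau / 15) * D (s * m + j)%N
    + (3 / 2 * tau ^+ 2 * L + tau * mu / 6 + tau ^+ 2 * mu / 30)
      * Z (s * m + j)%N
    - (3 / 2 * tau ^+ 2 * L + tau * mu / 2) * Z (s * m + j).+1.
Proof.
move=> sS jm; have kS : (s * m + j < S * m)%N.
  apply: (@leq_trans (s.+1 * m)); last by rewrite leq_mul2r sS orbT.
  by rewrite mulSn addnC ltn_add2r.
pose k := Ordinal kS.
have [_ tau2L muL] := epoch_length mu_gt0 L_ge_mu mE.
rewrite -/tau in tau2L muL.
pose x (w : Omega) := it_x (r w) k.+1; pose xt (w : Omega) := it_snap (r w) s.
pose ea (i : 'I_A) : I := (k, inl i); pose eb (i : 'I_B) : I := (k, inr i).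
pose g (w : Omega) := grad_est (avg F_) G_ (w \o ea) (w \o eb) (x w) (xt w).
pose e2 (w : Omega) := dotp (g w - grad f (x w)) (g w - grad f (x w)).
pose d2 (w : Omega) := dotp (x w - xt w) (x w - xt w).
have x_upd w u v : x (upd w (k, u) v) = x w.
  apply: (sock_x_adapted h_pcc h_sc mu_gt0 (ltW L_gt0) alpha_ge0 m_gt0 x0_dom
    (r_sock _) (r_sock _) sS jm).
  by move=> l lk; exact: upd_draws.
have xt_upd w u v : xt (upd w (k, u) v) = xt w.
  apply: (sock_snap_adapted h_pcc h_sc mu_gt0 (ltW L_gt0) alpha_ge0 m_gt0 x0_dom
    (r_sock _) (r_sock _) (ltnW kS)) => [l lk||].
  - exact: upd_draws.
  - exact: ltnW.
  - exact: leq_addr.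
have gE w : g w = grad_est (avg F_) G_ (a w k) (b w k) (x w) (xt w).
  have wa : w \o ea = a w k by apply/funext => i; exact/esym/aE.
  have wb : w \o eb = b w k by apply/funext => i; exact/esym/bE.
  by rewrite /g wa wb.
have Ee2 : \sum_w e2 w <= mu ^+ 2 / 180 * \sum_w d2 w.
  have ea_inj : injective ea by move=> i i' [].
  have eb_inj : injective eb by move=> i i' [].
  have ea_eb i i' : ea i != eb i' by apply/eqP.
  have := grad_est_variance n1_gt0 n2_gt0 F_smooth F_bounded G_smooth G_bounded
    A_gt0 B_gt0 ea_inj eb_inj ea_eb (fun w i => x_upd w _)
    (fun w i => xt_upd w _) (fun w i => x_upd w _) (fun w i => xt_upd w _).
  move=> /le_trans; apply; apply: ler_wpM2r variance_bound.
  by apply: sumr_ge0 => w _; exact: dotp_ge0.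
have step w :
    gap (it_y (r w) k.+1) <= tau * gap (xt w) + (1 - 2 * tau) * gap (it_y (r w) k)
      + (3 / 2 * tau ^+ 2 * L + tau * mu / 6) * dist2 (it_z (r w) k)
      - (3 / 2 * tau ^+ 2 * L + tau * mu / 2) * dist2 (it_z (r w) k.+1)
      + 3 * (tau / mu) * e2 w /\
    d2 w <= 2 * tau * dist2 (it_z (r w) k)
      + 4 / mu * (1 - 2 * tau) * gap (it_y (r w) k) + 4 / mu * gap (xt w).
  have [yd zd] := sock_dom h_pcc m_gt0 x0_dom (r_sock w) (ltnW kS).
  have xtd := sock_snap_dom h_pcc theta_gt0 m_gt0 x0_dom (r_sock w) (ltnW sS).
  have xE := sock_x (r_sock w) sS jm.
  have zmin := sock_z (r_sock w) sS jm; have ymin := sock_y (r_sock w) sS jm.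
  have cE : (2 * alpha)^-1 = 3 * tau * L / 2.
    by rewrite /alpha; field; rewrite !gt_eqF.
  rewrite /= cE -(gE w) in zmin; rewrite /= -(gE w) in ymin.
  split.
    exact: (accelerated_step mu_gt0 L_gt0 df fL f_convex h_pcc h_sc xs_min
      x0_dom tau_gt0 tau_le muL xtd yd xE zmin ymin).
  exact: (sqr_dist_snapshot mu_gt0 L_gt0 df fL f_convex h_pcc h_sc xs_min
    tau_gt0 tau_le xtd yd xE).
have lin (v u1 u2 u3 u4 u5 : Omega -> R) c1 c2 c3 c4 c5 :
    (forall w, v w <= c1 * u1 w + c2 * u2 w + c3 * u3 w - c4 * u4 w + c5 * u5 w) ->
    \sum_w v w <= c1 * \sum_w u1 w + c2 * \sum_w u2 w + c3 * \sum_w u3 w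
      - c4 * \sum_w u4 w + c5 * \sum_w u5 w.
  move=> vu; apply: (le_trans (ler_sum _ (fun w _ => vu w))).
  by rewrite !big_split /= sumrN -!mulr_sumr.
have E1 : D k.+1 <= tau * Dt s + (1 - 2 * tau) * D k
    + (3 / 2 * tau ^+ 2 * L + tau * mu / 6) * Z k
    - (3 / 2 * tau ^+ 2 * L + tau * mu / 2) * Z k.+1
    + 3 * (tau / mu) * \sum_w e2 w.
  by apply: lin => w; have [] := step w.
have E2 : \sum_w d2 w <= 2 * tau * Z k + 4 / mu * (1 - 2 * tau) * D k
    + 4 / mu * Dt s - 0 * Z k + 0 * Z k.
  by apply: lin => w; rewrite !mul0r subr0 addr0; have [] := step w.
rewrite !mul0r subr0 addr0 in E2.
have c0 : 0 <= 3 * (tau / mu) by rewrite mulr_ge0 // divr_ge0 // ltW.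
have mu2 : 0 <= mu ^+ 2 / 180 by rewrite divr_ge0 // exprn_ge0 // ltW.
(* The overall factor is 3 (tau / mu) mu^2 / 180 = tau mu / 60: times 4 / mu it gives tau / 15 on
   the gaps, times 2 tau it gives tau^2 mu / 30 on the distance. *)
have := ler_wpM2l c0 (le_trans Ee2 (ler_wpM2l mu2 E2)).
have -> : 3 * (tau / mu) * (mu ^+ 2 / 180 * (2 * tau * Z k
      + 4 / mu * (1 - 2 * tau) * D k + 4 / mu * Dt s))
    = tau ^+ 2 * mu / 30 * Z k + tau / 15 * ((1 - 2 * tau) * D k + Dt s).
  by field; rewrite gt_eqF.
by move: (tau) mu_gt0 E1 => t mu0 E1; lra.
Qed.

Lemma expected_rate :
  Dt S <= 11 * (12 / 13) ^+ S * \sum_(w : Omega) gap x0.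
Proof.
have gap0 w : it_y (r w) 0 = x0 /\ it_z (r w) 0 = x0 /\ it_snap (r w) 0 = x0.
  by split; [exact: sock_y0 (r_sock w) | split;
    [exact: sock_z0 (r_sock w) | exact: sock_snap0 (r_sock w)]].
have gap_pos u := gap_ge0 mu_gt0 L_gt0 df fL f_convex h_pcc h_sc xs_min
  (u := u).
have gap_gr u := gap_growth L_gt0 df fL f_convex h_pcc h_sc xs_min
  (u := u).
have [_ tau2L muL] := epoch_length mu_gt0 L_ge_mu mE; rewrite -/tau in tau2L.
have [tau0 tau1] := (tau_gt0, tau_le); have [mu0 L0] := (mu_gt0, L_gt0).
have D0E : \sum_(w : Omega) gap x0 = D 0.
  by apply: eq_bigr => w _; have [-> _] := gap0 w.
have tm := mulr_ge0 (ltW tau0) (ltW mu0).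
have t2m := mulr_ge0 (ltW tau0) tm.
have tL : 0 <= tau ^+ 2 * L by rewrite mulr_ge0 ?exprn_ge0 // ltW.
rewrite D0E.
apply: (@linear_rate R S m D Z Dt
  (3 / 2 * tau ^+ 2 * L + tau * mu / 6 + tau ^+ 2 * mu / 30)
  (3 / 2 * tau ^+ 2 * L + tau * mu / 2) m_gt0).
- lra.
(* Since tau^2 L <= mu, the factor theta enlarges 3/2 tau^2 L by at most tau mu / 4. With the tau mu
   / 6 of p this makes 5/12 tau mu, and for tau <= 1/2 the higher-order terms fit into the remaining
   tau mu / 12. *)
- have -> : 1 + (12 * m%:R)^-1 = 1 + tau / 6 :> R.
    by rewrite /tau; field; rewrite pnatr_eq0 -lt0n.
  have := ler_wpM2l (ltW tau0) tau2L.
  have : tau * (tau * mu) <= 2^-1 * (tau * mu) by rewrite ler_wpM2r //; lra.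
  have : tau * (tau * (tau * mu)) <= 2^-1 * (tau * (tau * mu)).
    by rewrite ler_wpM2r //; lra.
  lra.
- move=> k kS; apply: sumr_ge0 => w _; apply: gap_pos.
  by have [] := sock_dom h_pcc m_gt0 x0_dom (r_sock w) kS.
- by move=> k; apply: sumr_ge0 => w _; exact: dotp_ge0.
- move=> s sS; apply: sumr_ge0 => w _; apply: gap_pos.
  exact: (sock_snap_dom h_pcc theta_gt0 m_gt0 x0_dom (r_sock w) sS).
- exact: expected_step.
- move=> s sS; rewrite /Dt mulr_sumr.
  have -> : \sum_(j < m) theta ^+ j * D (s * m + j).+1 = \sum_(w : Omega)
      \sum_(j < m) theta ^+ j * gap (it_y (r w) (s * m + j).+1).
    by rewrite exchange_big; apply: eq_bigr => j _; rewrite mulr_sumr.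
  apply: ler_sum => w _.
  by have [] := sock_snap_jensen h_pcc theta_gt0 m_gt0 x0_dom (r_sock w)
    (gap_convex xs f_convex h_pcc) sS.
- by apply: eq_bigr => w _; have [-> [_ ->]] := gap0 w.
(* All trajectories start at x0, where strong convexity gives mu Z 0 <= 2 D 0; and p <= 8/5 mu
   because tau^2 L <= mu and tau <= 1/2. *)
- have : mu / 2 * Z 0 <= D 0.
    rewrite /Z mulr_sumr; apply: ler_sum => w _.
    by have [-> [-> _]] := gap0 w; exact: gap_gr.
  have Z0 : 0 <= Z 0 by apply: sumr_ge0 => w _; exact: dotp_ge0.
  have := ler_wpM2r Z0 tau2L; have := mulr_ge0 t2m Z0.
  have : tau * (mu * Z 0) <= 2^-1 * (mu * Z 0).
    by rewrite ler_wpM2r ?mulr_ge0 ?(ltW mu0) //; lra.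
  have : tau * (tau * mu * Z 0) <= 2^-1 * (tau * mu * Z 0).
    by rewrite ler_wpM2r ?mulr_ge0 ?(ltW mu0) ?(ltW tau0) //; lra.
  have := mulr_ge0 (ltW mu0) Z0.
  lra.
Qed.

End expectation.

(** * Reduction of the probability space to finitely many outcomes *)

Unset Implicit Arguments.

Theorem theorem4p4 (R : realType) (N1 N2 n1 n2 : nat)
  (F_ : 'I_n1 -> 'rV[R]_N1 -> R^o) (G_ : 'I_n2 -> 'rV[R]_N2 -> 'rV[R]_N1)
  (h : 'rV[R]_N2 -> \bar R)
  (F : 'rV[R]_N1 -> R^o) (G : 'rV[R]_N2 -> 'rV[R]_N1)
  (f : 'rV[R]_N2 -> R^o) (H : 'rV[R]_N2 -> \bar R)
  (LF BF LG BG L mu : R) (xstar x0 : 'rV[R]_N2)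
  (S m A B : nat) (theta alpha tau1 tau2 : R)
  (d : measure_display) (T : measurableType d) (P : probability T R)
  (a : nat -> 'I_A -> T -> 'I_n2) (b : nat -> 'I_B -> T -> 'I_n2)
  (run : T -> iterates R N2)
  (N1_gt0 : (0 < N1)%N) (N2_gt0 : (0 < N2)%N)
  (n1_gt0 : (0 < n1)%N) (n2_gt0 : (0 < n2)%N)
  (F_def : F = avg F_) (G_def : G = avg G_)
  (f_def : f = F \o G) (H_def : H = fun x => ((f x)%:E + h x)%E)
  (h_pcc : proper_closed_convex h)
  (f_convex : @convex_function R 'rV[R]_N2 [set: 'rV[R]_N2] f)
  (mu_gt0 : 0 < mu) (h_sc : strongly_convex mu h)
  (F_smooth : forall i, smooth_fun LF (F_ i))
  (F_bounded : forall i x, enorm (grad (F_ i) x) <= BF)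
  (G_smooth : forall j, smooth_map LG (G_ j))
  (G_bounded : forall j x, specnorm (jac (G_ j) x) <= BG)
  (L_smooth : forall i j x y,
     enorm (trmul (jac (G_ j) x) (grad (F_ i) (G x))
            - trmul (jac (G_ j) y) (grad (F_ i) (G y))) <= L * enorm (x - y))
  (L_ge_mu : mu <= L)
  (xstar_min : is_minimizer H xstar)
  (x0_dom : (h x0 < +oo)%E)
  (m_def : m%:Z = Num.ceil (2^-1 * Num.sqrt (L / mu)))
  (tau1_def : tau1 = (2 * m%:R)^-1) (tau2_def : tau2 = (2 * m%:R)^-1)
  (theta_def : theta = 1 + (12 * m%:R)^-1)
  (alpha_def : alpha = (3 * tau1 * L)^-1)
  (A_def : A%:Z = Num.max 1 (Num.ceil (720 * BG ^+ 4 * LF ^+ 2 / mu ^+ 2)))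
  (B_def : B%:Z = Num.max 1 (Num.ceil (720 * BF ^+ 2 * LG ^+ 2 / mu ^+ 2)))
  (S_ge1 : (1 <= S)%N)
  (draws_iid : @iid_uniform d T R P _ n2 (@all_draws T n2 (S * m) A B a b))
  (run_sock : forall w : T,
     sock F G_ h L x0 S m theta alpha tau1 tau2
       (fun k i => a k i w) (fun k i => b k i w) (run w)) :
  (\int[P]_w (H (it_snap (run w) S) - H xstar)
   <= (11 * (12 / 13) ^+ S)%:E * (H x0 - H xstar))%E.
Proof.
subst F G f H alpha tau1 tau2 theta.
set tau := (2 * m%:R)^-1 in run_sock *; set f := avg F_ \o avg G_.
pose X := @all_draws T n2 (S * m) A B a b.
pose I : finType := ('I_(S * m) * ('I_A + 'I_B))%type.
(* A representative sample point for each outcome; the trajectories at these points form the finite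
   family to which [expected_rate] applies. *)
have [W WX] : exists W : {ffun I -> 'I_n2} -> T, forall w i, X i (W w) = w i.
  by have [W ?] := choice (draws_attained n2_gt0 draws_iid); exists W.
have L_gt0 : 0 < L by apply: lt_le_trans L_ge_mu.
have [m_gt0 _ _] := epoch_length mu_gt0 L_ge_mu m_def.
have mR : 0 < m%:R :> R by rewrite ltr0n.
have tau_gt0 : 0 < tau by rewrite invr_gt0 mulr_gt0.
have alpha_ge0 : 0 <= (3 * tau * L)^-1 by rewrite invr_ge0 !mulr_ge0 // ltW.
have theta_gt0 : 0 < 1 + (12 * m%:R)^-1 :> R.
  by rewrite addr_gt0 // invr_gt0 mulr_gt0.
(* By uniqueness of the prox steps the snapshots at t agree with those at the representative of its
   draws, so the integrand is a function of the outcome. *)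
have runE t s : (s <= S)%N ->
    it_snap (run t) s = it_snap (run (W [ffun i => X i t])) s.
  move=> sS; apply: (sock_snap_adapted h_pcc h_sc mu_gt0 (ltW L_gt0) alpha_ge0
    m_gt0 x0_dom (run_sock t) (run_sock _) (leqnn _)) => // [k kS|].
    have Xk c : X (Ordinal kS, c) t
        = X (Ordinal kS, c) (W [ffun i => X i t]) by rewrite WX ffunE.
    by split; apply/funext => u; [exact: Xk (inl u) | exact: Xk (inr u)].
  by rewrite leq_mul2r sS orbT.
have gapE u : (h u < +oo)%E ->
    ((f u)%:E + h u - ((f xstar)%:E + h xstar) = (gap f h xstar u)%:E)%E.
  move=> hu; have hs := minimizer_dom h_pcc xstar_min x0_dom.
  by rewrite (proper_fineK h_pcc hu) (proper_fineK h_pcc hs).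
pose psi (w : {ffun I -> 'I_n2}) := gap f h xstar (it_snap (run (W w)) S).
have snap_dom t : (h (it_snap (run t) S) < +oo)%E.
  exact: (sock_snap_dom h_pcc theta_gt0 m_gt0 x0_dom (run_sock t) (leqnn S)).
rewrite (eq_integral (fun t => (psi [ffun i => X i t])%:E)); last first.
  by move=> t _; rewrite gapE // runE.
have df := differentiable_compositional F_smooth G_smooth.
have fL x y : enorm (grad f x - grad f y) <= L * enorm (x - y).
  exact: (grad_compositional_lipschitz n1_gt0 n2_gt0 F_smooth G_smooth).
rewrite (integral_draws draws_iid); last first.
  move=> w; apply: (gap_ge0 mu_gt0 L_gt0 df fL f_convex h_pcc h_sc xstar_min).
  exact: snap_dom.
rewrite gapE // -EFinM lee_fin.
have rate := expected_rate n1_gt0 n2_gt0 h_pcc h_sc mu_gt0 L_ge_mu F_smooth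
  F_bounded G_smooth G_bounded L_smooth f_convex xstar_min x0_dom m_def A_def
  B_def (a := fun w k i => a k i (W w)) (b := fun w k i => b k i (W w))
  (r := fun w => run (W w)) (fun w k i => WX w (k, inl i))
  (fun w k i => WX w (k, inr i)) (fun w => run_sock (W w)).
have n0 : 0 < n2%:R^-1 ^+ #|I| :> R by rewrite exprn_gt0 // invr_gt0 ltr0n.
apply: (le_trans (ler_wpM2l (ltW n0) rate)).
(* The number n2^|I| of outcomes, from the sum of the constant initial gap, cancels the probability
   of each one. *)
rewrite sumr_const card_ffun card_ord mulrCA.
rewrite -[X in _ * (_ * X)]mulr_natl natrX [n2%:R^-1 ^+ _ * _]mulrA -exprMn.
by rewrite mulVf ?expr1n ?mul1r // pnatr_eq0 -lt0n.
Qed.
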